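(* 1) Let $R_0$ be the unique solution in $]0,1[$ of the equation $$\sum_{n\ge 1,\ n \text{ even}}\frac{4R^{n}}{1+R^{2n}}+\sum_{n\ge 1,\ n\text{ odd}}\frac{4R^{n}}{1-R^{2n}}=1 .$$ If $0<R\le R_0$, then the Bohr phenomenon holds for the ellipse $\mathscr E=\mathscr E_R$ in the class of all holomorphic functions $f:\mathscr E\to\mathbb D$. 2) Let $R_1$ be the unique solution in $]0,1[$ of the equation $$\sum_{n=1}^{\infty}\frac{4R^n}{1+R^{2n}}=1 .$$ If $0<R\le R_1$, then the Bohr phenomenon holds for the ellipse $\mathscr E=\mathscr E_R$ in the class of all holomorphic functions $f:\mathscr E\to\mathbb D$ with real coefficients.
   Context: $\mathbb D$ is the open unit disc and $K=[-1,1]\subset\mathbb C$. For $0<R<1$, $\mathscr E=\mathscr E_R$ is the open domain bounded by the ellipse $\{\tfrac12(\tfrac wR+\tfrac Rw): |w|=1\}$ with foci $\pm1$; thus $\mathscr E\setminus K=\{\tfrac12(\tfrac wR+\tfrac Rw): R<|w|<1\}$. The Faber polynomials of $\mathscr E$ are the polynomials $F_{\mathscr E,0}=1$ and, for $n\ge1$, $F_{\mathscr E,n}$ determined by $F_{\mathscr E,n}\big(\tfrac12(\tfrac wR+\tfrac Rw)\big)=w^n+R^{2n}w^{-n}$; in particular $\sup_K|F_{\mathscr E,n}|=2R^n$ for $n\ge 1$. Every $f$ holomorphic on $\mathscr E$ has a unique expansion $f=\sum_{n\ge0}a_nF_{\mathscr E,n}$, $a_n\in\mathbb C$, converging uniformly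 on compact subsets of $\mathscr E$. ''With real coefficients'' means that all $a_n$ in this expansion are real. The Bohr phenomenon holds for $\mathscr E$ in a given class of holomorphic functions if for every $f=\sum_{n\ge 0}a_nF_{\mathscr E,n}$ in this class with $|f(z)|<1$ for all $z\in\mathscr E$, one has $\sum_{n\ge0}|a_n|\sup_K|F_{\mathscr E,n}|<1$. *)

(* Defs.v *)
From HB Require Import structures.
From mathcomp Require Import all_boot all_order all_algebra.
From mathcomp Require Import complex.
From mathcomp Require Import all_classical all_reals all_analysis.
From mathcomp Require Import ring lra.

Set Implicit Arguments.
Unset Strict Implicit.
Unset Printing Implicit Defensive.

Import Order.TTheory GRing.Theory Num.Theory.
Import numFieldNormedType.Exports.
Import Normc.

Local Open Scope classical_set_scope.
Local Open Scope ring_scope.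
Local Open Scope complex_scope.

Section BohrEllipse.
Variable R : realType.
Implicit Types (r : R) (w z : R[i]).

Definition joukowski r w : R[i] := 2^-1 * (w / r%:C + r%:C / w).

Definition focal_segment : set R[i] := [set x%:C | x in `[-1, 1]].

(* Removing the segment leaves the image of the annulus; the segment itself is
   the image of the inner circle.  See [ellipse_focal] for the description by
   the sum of the distances to the foci. *)
Definition ellipse r : set R[i] :=
  focal_segment `|` [set joukowski r w | w in [set w | r < normc w < 1]].

(* The polynomial is picked by its values; existence and uniqueness are
   [faber_joukowski] and [faber_unique]. *)
Definition faber r (n : nat) : {poly R[i]} :=
  if n is 0 then 1
  else xget 0 [set p : {poly R[i]} | forall w, w != 0 ->
         p.[joukowski r w] = w ^+ n + (r ^+ (2 * n))%:C * w ^- n].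

Lemma joukowski_surj r z : 0 < r ->
  exists2 w, w != 0 & joukowski r w = z.
Proof.
move=> r0; have rC : r%:C != 0 :> R[i] by rewrite (inj_eq (@complexI R)) gt_eqF.
set s := sqrtC (z ^+ 2 - 1).
have sE : s ^+ 2 = z ^+ 2 - 1 by rewrite sqrtCK.
have zsM : (z + s) * (z - s) = 1 by rewrite mulrC -subr_sqr sE subKr.
have zs0 : z + s != 0.
  by apply/eqP => h; move: zsM; rewrite h mul0r => /eqP; rewrite eq_sym oner_eq0.
have iE : (z + s)^-1 = z - s by rewrite -[LHS]mulr1 -zsM mulKf.
exists (r%:C * (z + s)); first by rewrite mulf_neq0.
rewrite /joukowski mulrAC mulfV// mul1r invfM mulrA mulfV// mul1r iE.
by field.
Qed.

Lemma faber_unique r (p q : {poly R[i]}) : 0 < r ->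
  (forall w, w != 0 -> p.[joukowski r w] = q.[joukowski r w]) -> p = q.
Proof.
move=> r0 pq; apply/eqP; rewrite -subr_eq0; apply/negPn/negP => /closed_nonrootP[z].
have [w w0 <-] := joukowski_surj z r0.
by rewrite /root hornerD hornerN pq// subrr eqxx.
Qed.

Lemma faber_joukowski r n w : 0 < r -> w != 0 ->
  (faber r n.+1).[joukowski r w] = w ^+ n.+1 + (r ^+ (2 * n.+1))%:C * w ^- n.+1.
Proof.
move=> r0; rewrite /faber; case: xgetP => [p _ + w0|no]; first exact.
exfalso; have rC : r%:C != 0 :> R[i] by rewrite (inj_eq (@complexI R)) gt_eqF.
have [p pP] : exists p : nat -> {poly R[i]}, forall k u, u != 0 ->
    (p k).[joukowski r u] = u ^+ k + (r ^+ (2 * k))%:C * u ^- k /\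
    (p k.+1).[joukowski r u] = u ^+ k.+1 + (r ^+ (2 * k.+1))%:C * u ^- k.+1.
  pose t : {poly R[i]} := (2 * r%:C) *: 'X.
  pose g := fix g k : {poly R[i]} * {poly R[i]} :=
    if k is k'.+1 then ((g k').2, t * (g k').2 - (r%:C ^+ 2) *: (g k').1)
    else (2%:P, t).
  exists (fun k => (g k).1) => k u u0; elim: k => [|k [IH1 IH2]].
    rewrite /= hornerC hornerZ hornerX muln0 !expr0 /joukowski muln1 rmorphXn.
    split; first by rewrite invr1 mulr1.
    by field; rewrite u0 rC.
  split=> //; rewrite [(g k.+2).1]/= -/((g k.+1).1) hornerD hornerN hornerM.
  rewrite hornerZ hornerX hornerZ IH1 [((g k).2)](_ : _ = (g k.+1).1)// IH2.
  rewrite /joukowski !rmorphXn !exprM !exprS.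
  by field; rewrite ?u0 ?rC ?expf_neq0.
by apply: (no (p n.+1)) => u u0; have [] := pP n.+1 u u0.
Qed.

Lemma joukowski_focal r w : 0 < r -> w != 0 ->
  normc (joukowski r w - 1) + normc (joukowski r w + 1) =
  normc w / r + r / normc w.
Proof.
move=> r0 w0; have rC : r%:C != 0 :> R[i] by rewrite (inj_eq (@complexI R)) gt_eqF.
have nw0 : normc w != 0 by apply: contra_neq w0 => /eq0_normc.
have nsqr u : normc u ^+ 2 = complex.Re u ^+ 2 + complex.Im u ^+ 2.
  by case: u => a b /=; rewrite sqr_sqrtr// addr_ge0 ?sqr_ge0.
have nr : normc r%:C = r by rewrite /= expr0n addr0 sqrtr_sqr gtr0_norm.
have n2 : normc (2%:R : R[i]) = 2 by rewrite -[1]/(1%:C) normcMn normc1.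
have -> : joukowski r w - 1 = (w - r%:C) * (w - r%:C) / (2%:R * r%:C * w).
  by rewrite /joukowski; field; rewrite w0 rC.
have -> : joukowski r w + 1 = (w + r%:C) * (w + r%:C) / (2%:R * r%:C * w).
  by rewrite /joukowski; field; rewrite w0 rC.
rewrite !normcM normcV !normcM nr n2 -mulrDl -!expr2 !nsqr.
have -> : normc w / r + r / normc w = (normc w ^+ 2 + r ^+ 2) / (r * normc w).
  by field; rewrite nw0 gt_eqF.
rewrite nsqr; have rn0 := gt_eqF r0.
by case: w w0 nw0 => a b /= _ nw0; field; rewrite nw0 rn0.
Qed.

Lemma ellipse_focal r : 0 < r < 1 ->
  ellipse r = [set z | normc (z - 1) + normc (z + 1) < r + r^-1].
Proof.
move=> /andP[r0 r1].
have mono t : r <= t -> (t / r + r / t < r + r^-1) = (t < 1).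
  move=> rt; have t0 : 0 < t by apply: lt_le_trans rt.
  have E : r + r^-1 - (t / r + r / t) = (1 - t) * ((t - r ^+ 2) / (r * t)).
    by field; rewrite !gt_eqF.
  rewrite -subr_gt0 E pmulr_lgt0 ?subr_gt0// divr_gt0 ?mulr_gt0// subr_gt0.
  by apply: lt_le_trans rt; rewrite expr2 gtr_pMl.
have rr : r / r = 1 by rewrite mulfV// gt_eqF.
apply/seteqP; split => z /=.
- case=> [[x /=]|[w /= /andP[rw w1] <-]].
    rewrite in_itv/= => /andP[x1 x2] <-.
    rewrite -[1]/(1%:C) -rmorphB -rmorphD /= !expr0n !addr0 !sqrtr_sqr.
    rewrite ler0_norm ?subr_le0// ger0_norm; last by rewrite -lerBlDr sub0r.
    have := mono r (lexx r); rewrite rr r1 => h.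
    by apply: le_lt_trans h; lra.
  rewrite joukowski_focal ?mono// ?ltW//.
  by apply/eqP => w0; move: rw; rewrite w0 normc0 ltNge ltW.
- have rC : r%:C != 0 :> R[i] by rewrite (inj_eq (@complexI R)) gt_eqF.
  have nr : normc r%:C = r by rewrite /= expr0n addr0 sqrtr_sqr gtr0_norm.
  have [w [w0 rw <-]] : exists w, [/\ w != 0, r <= normc w & joukowski r w = z].
    have [w w0 <-] := joukowski_surj z r0.
    have [rw|wr] := leP r (normc w); first by exists w.
    have nw0 : normc w != 0 by apply: contra_neq w0 => /eq0_normc.
    have nwp : 0 < normc w by rewrite lt_def nw0; case: (w) => a b; apply: sqrtr_ge0.
    exists (r%:C * r%:C / w); split; first by rewrite !mulf_neq0 ?invr_eq0.
      by rewrite !normcM normcV nr ler_pdivlMr// ler_pM2l// ltW.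
    by rewrite /joukowski; field; rewrite rC w0.
  rewrite joukowski_focal// mono// => w1.
  move: rw; rewrite le_eqVlt => /orP[/eqP rw|rw]; last first.
    by right; exists w => //=; rewrite rw.
  left; have : normc w ^+ 2 = r ^+ 2 by rewrite -rw.
  case: w w0 {rw w1} => a b w0 /=; rewrite sqr_sqrtr ?addr_ge0 ?sqr_ge0// => ab.
  exists (a / r).
    rewrite /= in_itv/= ler_pdivlMr// ler_pdivrMr// mulN1r mul1r -ler_norml.
    rewrite -(@ler_pXn2r _ 2) ?nnegrE ?normr_ge0 ?(ltW r0)//.
    by rewrite real_normK ?num_real// -ab lerDl sqr_ge0.
  have E : joukowski r (a +i* b) = 2^-1 * ((a +i* b) / r%:C + (a -i* b) / r%:C).
    rewrite /joukowski; congr (_ * (_ + _)).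
    apply: (mulIf w0); rewrite mulfVK// mulrAC.
    have -> : (a -i* b) * (a +i* b) = r%:C * r%:C.
      by rewrite -rmorphM -expr2 -ab; simpc; congr (_ +i* _); ring.
    by rewrite mulfK.
  rewrite E -mulrDl (_ : (a +i* b) + (a -i* b) = 2 * a%:C).
    by rewrite rmorphM fmorphV /=; field.
  rewrite -[2]/(1 + 1) mulrDl mul1r; apply/eqP.
  by rewrite eq_complex /= subrr addr0 !eqxx.
Qed.

(* R[i]^o is R[i] with its usual topology, normed over itself: derivability
   is complex differentiability. *)
Definition holomorphic_on (D : set R[i]) (f : R[i] -> R[i]) : Prop :=
  forall z, D z -> derivable (f : R[i]^o -> R[i]^o) z 1.

Definition faber_expansion r (f : R[i] -> R[i]) (a : nat -> R[i]) : Prop :=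
  forall A : set R[i]^o, compact A -> A `<=` ellipse r ->
    {uniform A, (fun N : nat => (fun z : R[i]^o =>
       (\sum_(0 <= n < N) a n * (faber r n).[z] : R[i]^o))) @ \oo -->
      (f : R[i]^o -> R[i]^o)}.

Definition sup_segment (p : {poly R[i]}) : R :=
  sup [set normc p.[z] | z in focal_segment].

Definition bohr_phenomenon r (X : set (R[i] -> R[i])) : Prop :=
  forall (f : R[i] -> R[i]) (a : nat -> R[i]),
    X f -> faber_expansion r f a ->
    (forall z, ellipse r z -> normc (f z) < 1) ->
    (\sum_(0 <= n <oo) (normc (a n) * sup_segment (faber r n))%:E < 1)%E.

Definition real_faber_coefs r (f : R[i] -> R[i]) : Prop :=
  forall a, faber_expansion r f a -> forall n, a n \is Num.real.

Definition bohr_eq0 r : Prop :=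
  (\sum_(1 <= n <oo | ~~ odd n) (4 * r ^+ n / (1 + r ^+ (2 * n)))%:E +
   \sum_(1 <= n <oo | odd n) (4 * r ^+ n / (1 - r ^+ (2 * n)))%:E = 1)%E.

Definition bohr_eq1 r : Prop :=
  (\sum_(1 <= n <oo) (4 * r ^+ n / (1 + r ^+ (2 * n)))%:E = 1)%E.

End BohrEllipse.

(* Main.v *)
(** On the circle |w| = rho < 1 the function f o J is a Laurent series with
    coefficients a_n and r^(2n) a_n; putting q = r / rho and b_n = a_n rho^n
    turns a partial sum into b_0 + sum b_n (w^n + q^(2n) w^(-n)) on |w| = 1,
    bounded there by any C > 1.  If |c| = 1 and c a_0 = |a_0|, then
    u = C - Re (c f) >= 0 has mean C - |a_0|, and its n-th Fourier coefficient
    is -(c b_n + q^(2n) conj (c b_n)) / 2.  For real coefficients this gives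
    |b_n| (1 + q^(2n)) <= 2 (C - |a_0|).  In general one solves for b_n:
    sum 2 q^n |b_n| is at most the mean of u times the maximum over |e| = 1 of
    sum 4 q^n |1 - q^(2n) e^(2n)| / (1 - q^(4n)), and for q <= 1/4 this maximum
    is attained at e = i, where it is the left-hand side of the equation for
    R_0.  Letting C and rho tend to 1 bounds sum 2 r^n |a_n| by
    (1 - |a_0|) S(r) with S(r) <= 1.  The inequality is strict because a_n
    tends to 0 by Bessel, while the bound for the sum leaves at least
    2 r^n (1 - |a_0|) for the n-th term.  All means are taken over M-th roots
    of unity with M at least twice the degree, so that they are exact. *)

Require Import Defs.
From HB Require Import structures.
From mathcomp Require Import all_boot all_order all_algebra.
From mathcomp Require Import complex.
From mathcomp Require Import all_classical all_reals all_analysis.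
From mathcomp Require Import ring lra zify.
From mathcomp Require cyclotomic separable cyclic.

Import Order.TTheory GRing.Theory Num.Theory.
Import numFieldNormedType.Exports.
Import Normc.

Local Open Scope classical_set_scope.
Local Open Scope ring_scope.
Local Open Scope complex_scope.

Set Implicit Arguments.
Unset Strict Implicit.
Unset Printing Implicit Defensive.

(** * Complex norms and roots of unity *)

Section RootsOfUnity.
Variable R : realType.
Implicit Types (z w : R[i]).

(** In characteristic 0 the polynomial ['X^M - 1] is separable, so it has [M] distinct roots, and a
    field with that many [M]-th roots of unity contains a primitive one. *)
Lemma prim_root_complex M : (0 < M)%N -> exists z : R[i], M.-primitive_root z.
Proof.
pose p : {poly R[i]} := 'X^M - 1; have [r Dp] := closed_field_poly_normal p.
move=> M0; rewrite (monicP _) ?monicXnsubC // scale1r in Dp.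
have rM : all M.-unity_root r by apply/allP=> z; rewrite -root_prod_XsubC -Dp.
have sr : (M < (size r).+1)%N.
  by rewrite -(size_prod_XsubC r id) -Dp size_XnsubC.
have [|z _ zM] := hasP (cyclic.has_prim_root M0 rM _ sr); last by exists z.
rewrite -separable.separable_prod_XsubC -Dp.
by rewrite cyclotomic.separable_Xn_sub_1// pnatr_eq0 -lt0n.
Qed.

Lemma normc_ge0 z : 0 <= normc z.
Proof. by case: z => a b; exact: sqrtr_ge0. Qed.

Lemma normcX z n : normc (z ^+ n) = normc z ^+ n.
Proof. by elim: n => [|n IH]; rewrite ?normc1// !exprS normcM IH. Qed.

Lemma normc_real (x : R) : normc x%:C = `|x|.
Proof. by rewrite /= expr0n addr0 sqrtr_sqr. Qed.

Lemma normc_conj z : normc z^*%C = normc z.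
Proof. by case: z => a b /=; rewrite sqrrN. Qed.

Lemma Re_le_normc z : complex.Re z <= normc z.
Proof.
case: z => a b /=; apply: le_trans (ler_norm a) _.
by rewrite -sqrtr_sqr ler_wsqrtr// lerDl sqr_ge0.
Qed.

Lemma mulJc z : z^*%C * z = (normc z ^+ 2)%:C.
Proof.
case: z => a b /=; rewrite sqr_sqrtr ?addr_ge0 ?sqr_ge0//.
by apply/eqP; rewrite eq_complex /=; apply/andP; split; apply/eqP; ring.
Qed.

Lemma normc1_neq0 z : normc z = 1 -> z != 0.
Proof. by apply: contra_eq_neq => ->; rewrite normc0 eq_sym oner_eq0. Qed.

Lemma conjc_unit z : normc z = 1 -> z^*%C = z^-1.
Proof.
move=> z1; have z0 := normc1_neq0 z1.
by apply: (mulIf z0); rewrite mulJc mulVf// z1 expr1n.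
Qed.

Lemma normc_sum_le (I : Type) (s : seq I) (P : pred I) (F : I -> R[i]) :
  normc (\sum_(i <- s | P i) F i) <= \sum_(i <- s | P i) normc (F i).
Proof.
elim/big_ind2: _ => [|x1 x2 y1 y2 h1 h2|//]; first by rewrite normc0.
by apply: le_trans (le_normcD _ _) _; rewrite lerD.
Qed.

Lemma Re_sum (I : Type) (s : seq I) (P : pred I) (F : I -> R[i]) :
  complex.Re (\sum_(i <- s | P i) F i) = \sum_(i <- s | P i) complex.Re (F i).
Proof. exact: (raddf_sum (@complex.Re R : Rcomplex R -> R)). Qed.

Lemma conjc_realM (x : R) z : (x%:C * z)^*%C = x%:C * z^*%C.
Proof. by rewrite rmorphM; congr (_ * _); exact: conjc_real. Qed.

Lemma conjc_natM n z : (n%:R * z)^*%C = n%:R * z^*%C.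
Proof. by rewrite rmorphM; congr (_ * _); exact: conjc_nat. Qed.

Lemma conjc_affine (s x : R) z :
  (s%:C * (z + x%:C * z^*%C))^*%C = s%:C * (z^*%C + x%:C * z).
Proof. by case: z => a b; simpc; congr (_ +i* _); ring. Qed.

Lemma normc_root1 z M : (0 < M)%N -> z ^+ M = 1 -> normc z = 1.
Proof.
move=> M0 zM; have : normc z ^+ M = 1 by rewrite -normcX zM normc1.
by move/eqP; rewrite pexpr_eq1 ?normc_ge0// => /eqP.
Qed.

(** If [M] does not divide [m], multiplying the geometric sum by [z ^+ m - 1], which is nonzero,
    telescopes it to 0. *)
Lemma sum_prim_root M z m : M.-primitive_root z ->
  \sum_(j < M) (z ^+ j) ^+ m = if (M %| m)%N then M%:R else 0.
Proof.
move=> zM; rewrite (eq_bigr (fun j : 'I_M => (z ^+ m) ^+ j)); last first.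
  by move=> j _; rewrite -!exprM mulnC.
rewrite (prim_order_dvd zM).
have [/eqP zm1|zm1] := ifPn.
  by rewrite zm1 (eq_bigr (fun=> 1)) ?sumr_const ?card_ord// => j _; rewrite expr1n.
apply: (mulfI (_ : z ^+ m - 1 != 0)); first by rewrite subr_eq0.
by rewrite mulr0 -subrX1 -exprM mulnC exprM (prim_expr_order zM) expr1n subrr.
Qed.

End RootsOfUnity.

(** * Fourier coefficients over roots of unity *)

Section Fourier.
Variable R : realType.
Implicit Types (q C : R) (z w : R[i]) (b : nat -> R[i]).

(* The value of the n-th Faber polynomial in the coordinate w, for parameter q;
   the first one is 1 and not w^0 + q^0 w^0 = 2. *)
Definition laurent_faber q n w : R[i] :=
  if n is 0 then 1 else w ^+ n + (q ^+ (2 * n))%:C * w ^- n.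

Variables (N M : nat) (z : R[i]).
Hypotheses (zM : M.-primitive_root z) (NM : (2 * N <= M)%N).

Local Notation e j := (z ^+ j).

Let M0 : (0 < M)%N. Proof. exact: prim_order_gt0 zM. Qed.

Lemma normc_prim_root_pow j : normc (e j) = 1.
Proof. by rewrite normcX (normc_root1 M0 (prim_expr_order zM)) expr1n. Qed.

Lemma invX_prim_root_pow j k : (k <= M)%N -> e j ^- k = e j ^+ (M - k).
Proof.
move=> kM; have eM : e j ^+ M = 1.
  by rewrite -exprM mulnC exprM (prim_expr_order zM) expr1n.
have ek : e j ^+ k != 0 by rewrite expf_neq0// normc1_neq0// normc_prim_root_pow.
by apply: (mulfI ek); rewrite mulfV// -exprD subnKC.
Qed.

Let notdvd m : (0 < m < M)%N -> (M %| m)%N = false.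
Proof. by move=> /andP[m0 mM]; rewrite gtnNdvd. Qed.

(** No aliasing occurs: since [2 * N <= M], the exponents [n - k] and [- (n + k)] lie strictly
    between [- M] and [M], so only the exponent 0 survives. *)
Lemma sum_laurent_faberV q n k : (n < N)%N -> (k < N)%N ->
  \sum_(j < M) laurent_faber q n (e j) * e j ^- k = if n == k then M%:R else 0.
Proof.
move=> nN kN.
have H i : (i < N)%N -> \sum_(j < M) e j ^+ i * e j ^- k =
    if i == k then M%:R else 0.
  move=> iN.
  transitivity (\sum_(j < M) e j ^+ (i + (M - k))).
    by apply: eq_bigr => j _; rewrite invX_prim_root_pow ?exprD//; lia.
  rewrite (sum_prim_root _ zM); have [->|ik] := eqVneq i k.
    by rewrite subnKC ?dvdnn//; lia.
  have [ik'|ik'] := ltnP i k; first by rewrite notdvd//; lia.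
  rewrite (_ : (i + (M - k)) = (i - k) + M)%N ?dvdn_addl //; last by lia.
  by rewrite notdvd //; lia.
case: n nN => [|n] nN /=.
  by rewrite -(H 0%N)//; apply: eq_bigr => j _; rewrite expr0.
rewrite -(H n.+1)//.
transitivity (\sum_(j < M) (e j ^+ n.+1 * e j ^- k +
   (q ^+ (2 * n.+1))%:C * e j ^+ ((M - n.+1) + (M - k)))).
  by apply: eq_bigr => j _; rewrite exprD -!invX_prim_root_pow; [ring|lia|lia].
rewrite big_split /= -mulr_sumr (sum_prim_root _ zM).
rewrite (_ : (M - n.+1 + (M - k) = (M - n.+1 - k) + M)%N); last by lia.
by rewrite dvdn_addl// notdvd ?mulr0 ?addr0//; lia.
Qed.

Lemma sum_laurent_faber q n k : (n < N)%N -> (0 < k < N)%N ->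
  \sum_(j < M) laurent_faber q n (e j) * e j ^+ k =
  if n == k then M%:R * (q ^+ (2 * k))%:C else 0.
Proof.
move=> nN /andP[k0 kN]; case: n nN => [|n] nN /=.
  under eq_bigr do rewrite mul1r.
  by rewrite (sum_prim_root _ zM) notdvd; [case: k k0 kN|lia].
transitivity (\sum_(j < M) (e j ^+ (n.+1 + k) +
   (q ^+ (2 * n.+1))%:C * e j ^+ ((M - n.+1) + k))).
  by apply: eq_bigr => j _; rewrite !exprD -!invX_prim_root_pow; [ring|lia].
rewrite big_split /= -mulr_sumr !(sum_prim_root _ zM).
rewrite (notdvd (m := n.+1 + k)) ?add0r; last by lia.
have [<-|nk] := eqVneq n.+1 k; first by rewrite subnK ?dvdnn 1?mulrC//; lia.
have [nk'|nk'] := ltnP n.+1 k; last by rewrite notdvd ?mulr0//; lia.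
rewrite (_ : (M - n.+1 + k = (k - n.+1) + M)%N); last by lia.
by rewrite dvdn_addl// notdvd ?mulr0 ?addr0//; lia.
Qed.

Definition laurent_sum q b w : R[i] := \sum_(0 <= n < N) b n * laurent_faber q n w.

Lemma sum_laurent_sumV q b k : (k < N)%N ->
  \sum_(j < M) laurent_sum q b (e j) * e j ^- k = M%:R * b k.
Proof.
move=> kN; under eq_bigr do rewrite /laurent_sum mulr_suml.
rewrite exchange_big /=.
transitivity (\sum_(0 <= n < N) b n * if n == k then M%:R else 0 : R[i]).
  apply: eq_big_nat => n /= nN; rewrite -(@sum_laurent_faberV q)// mulr_sumr.
  by apply: eq_bigr => j _; rewrite mulrA.
rewrite (bigD1_seq k) ?mem_index_iota ?iota_uniq//= eqxx mulrC big1 ?addr0//.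
by move=> n /negPf ->; rewrite mulr0.
Qed.

Lemma sum_laurent_sum q b k : (0 < k < N)%N ->
  \sum_(j < M) laurent_sum q b (e j) * e j ^+ k =
  M%:R * ((q ^+ (2 * k))%:C * b k).
Proof.
move=> kN; under eq_bigr do rewrite /laurent_sum mulr_suml.
rewrite exchange_big /=.
transitivity (\sum_(0 <= n < N) b n *
    if n == k then M%:R * (q ^+ (2 * k))%:C else 0 : R[i]).
  apply: eq_big_nat => n /= nN; rewrite -(@sum_laurent_faber q)// mulr_sumr.
  by apply: eq_bigr => j _; rewrite mulrA.
rewrite (bigD1_seq k) ?mem_index_iota ?iota_uniq//=; last by lia.
rewrite eqxx big1 ?addr0; first by ring.
by move=> n /negPf ->; rewrite mulr0.
Qed.

(* The coefficients b_k are also those of s = sum b_k w^k, so s and the Laurent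
   sum L have the same inner product with s; compare
   with 2 |s L| <= |s|^2 + |L|^2. *)
Lemma bessel q b C : (forall j, normc (laurent_sum q b (e j)) <= C) ->
  \sum_(0 <= k < N) normc (b k) ^+ 2 <= C ^+ 2.
Proof.
move=> LC; have C0 : 0 <= C by apply: le_trans (LC 0%N); exact: normc_ge0.
pose S := \sum_(0 <= k < N) normc (b k) ^+ 2; rewrite -/S.
pose s w : R[i] := \sum_(0 <= k < N) b k * w ^+ k.
pose L := laurent_sum q b.
have sJ j : (s (e j))^*%C = \sum_(0 <= k < N) (b k)^*%C * e j ^- k.
  rewrite rmorph_sum; apply: eq_bigr => k _; rewrite rmorphM rmorphXn /=.
  by rewrite -exprVn -conjc_unit// normc_prim_root_pow.
have H (F : R[i] -> R[i]) :
    (forall k, (k < N)%N -> \sum_(j < M) F (e j) * e j ^- k = M%:R * b k) ->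
    \sum_(j < M) (s (e j))^*%C * F (e j) = (M%:R * S)%:C.
  move=> HF; under eq_bigr do rewrite sJ mulr_suml.
  rewrite exchange_big rmorphM rmorph_nat rmorph_sum mulr_sumr.
  apply: eq_big_nat => k /= kN; rewrite -mulJc mulrCA -HF// mulr_sumr.
  by apply: eq_bigr => j _; rewrite -mulrA [_ * F _]mulrC.
have sN : \sum_(j < M) normc (s (e j)) ^+ 2 = M%:R * S.
  apply: complexI; rewrite -(H s) ?rmorph_sum; last first.
    move=> k kN.
    (* At [q = 0] the Laurent sum loses its negative powers and becomes [s], so [H] applies to [s]
       itself. *)
    rewrite -(@sum_laurent_sumV 0 b)//; apply: eq_bigr => j _; congr (_ * _).
    rewrite /laurent_sum; apply: eq_bigr => -[|n] _ /=; rewrite ?expr0//.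
    by rewrite expr0n muln_eq0 /= mul0r addr0.
  by apply: eq_bigr => j _; rewrite mulJc.
have sL : \sum_(j < M) complex.Re ((s (e j))^*%C * L (e j)) = M%:R * S.
  have := congr1 (@complex.Re R) (H L (fun k => @sum_laurent_sumV q b k)).
  by rewrite Re_sum.
have : \sum_(j < M) complex.Re ((s (e j))^*%C * L (e j)) <=
    \sum_(j < M) (2^-1 * normc (s (e j)) ^+ 2 + 2^-1 * C ^+ 2).
  apply: ler_sum => j _; apply: le_trans (Re_le_normc _) _.
  rewrite normcM normc_conj; have := LC j; rewrite -/L.
  have := normc_ge0 (s (e j)); have := normc_ge0 (L (e j)).
  move: (normc (s _)) (normc (L _)) => x y y0 x0 yC.
  have : y ^+ 2 <= C ^+ 2 by rewrite lerXn2r.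
  have := sqr_ge0 (x - y); nra.
rewrite sL big_split /= -mulr_sumr sN sumr_const card_ord -(mulr_natl (2^-1 * C ^+ 2)).
have Mp : 0 < M%:R :> R by rewrite ltr0n.
have -> : 2^-1 * (M%:R * S) + M%:R * (2^-1 * C ^+ 2) =
    M%:R * (2^-1 * S + 2^-1 * C ^+ 2) by ring.
rewrite ler_pM2l//; lra.
Qed.

(** * The nonnegative function u and its Fourier coefficients *)

Section Positive.
Variables (q C : R) (b : nat -> R[i]) (c : R[i]).
Hypotheses (c1 : normc c = 1)
  (LC : forall j, normc (laurent_sum q b (e j)) <= C).

(** The function u of the overview, sampled at the roots of unity: a positive discrete measure whose
    total mass is given by [sum_defect]. *)
Definition defect j : R := C - complex.Re (c * laurent_sum q b (e j)).

Lemma defect_ge0 j : 0 <= defect j.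
Proof.
rewrite subr_ge0; apply: le_trans (Re_le_normc _) _.
by rewrite normcM c1 mul1r.
Qed.

Lemma defectE j : (defect j)%:C = C%:C -
  2^-1 * (c * laurent_sum q b (e j) + (c * laurent_sum q b (e j))^*%C).
Proof. by rewrite rmorphB/= ReJ_add mulrC. Qed.

Lemma sum_defect : (0 < N)%N ->
  \sum_(j < M) defect j = M%:R * (C - complex.Re (c * b 0%N)).
Proof.
move=> N0; rewrite /defect sumrB -Re_sum -mulr_sumr sumr_const card_ord.
rewrite -(mulr_natl C) mulrBr; congr (_ - _).
have := @sum_laurent_sumV q b 0%N N0; under eq_bigr do rewrite expr0 invr1 mulr1.
move=> ->; rewrite mulrCA; case: (c * b 0%N) => x y.
by rewrite !mulr_natl -[LHS]/(complex.Re (((x +i* y) : Rcomplex R) *+ M)) raddfMn.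
Qed.

Lemma sum_defectV k : (0 < k < N)%N ->
  \sum_(j < M) (defect j)%:C * e j ^- k =
  (- (M%:R / 2))%:C * (c * b k + (q ^+ (2 * k))%:C * (c * b k)^*%C).
Proof.
move=> kN; have := @sum_laurent_sumV q b k; have := @sum_laurent_sum q b k kN.
(* On the unit circle conjugation inverts [e j], so the conjugated sum against [e j ^+ k] is the sum
   of the conjugate of L against [e j ^- k]. *)
move=> /(congr1 (@conjc R)) /[swap] /(_ (proj2 (andP kN))).
move=> E1; rewrite rmorph_sum conjc_natM conjc_realM => E2.
under eq_bigr do rewrite defectE mulrBl -mulrA mulrDl mulrDr.
rewrite sumrB -mulr_sumr big_split /=.
have -> : \sum_(j < M) e j ^- k = 0.
  transitivity (\sum_(j < M) e j ^+ (M - k)).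
    by apply: eq_bigr => j _; rewrite invX_prim_root_pow//; lia.
  by rewrite (sum_prim_root _ zM) notdvd//; lia.
have -> : \sum_(j < M) 2^-1 * (c * laurent_sum q b (e j) * e j ^- k) =
    2^-1 * c * (M%:R * b k).
  by rewrite -E1 mulr_sumr; apply: eq_bigr => j _; rewrite !mulrA.
have -> : \sum_(j < M) 2^-1 * ((c * laurent_sum q b (e j))^*%C * e j ^- k) =
    2^-1 * c^*%C * (M%:R * ((q ^+ (2 * k))%:C * (b k)^*%C)).
  rewrite -E2 mulr_sumr; apply: eq_bigr => j _; rewrite !rmorphM rmorphXn /=.
  by rewrite (conjc_unit (normc_prim_root_pow j)) exprVn !mulrA.
rewrite rmorphN rmorphM fmorphV !rmorph_nat !rmorphM /=; by field.
Qed.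

End Positive.
End Fourier.

(** * Coefficient bounds from the positivity of u *)

Section Coefs.
Variable R : realType.
Variables (N M : nat) (z : R[i]).
Hypotheses (zM : M.-primitive_root z) (NM : (2 * N <= M)%N).
Variables (q C : R) (b : nat -> R[i]) (c : R[i]).
Hypotheses (q01 : 0 < q < 1) (c1 : normc c = 1)
  (LC : forall j, normc (laurent_sum N q b (z ^+ j)) <= C).

Local Notation u := (defect N z q C b c).

Let M0 : 0 < M%:R :> R. Proof. by rewrite ltr0n (prim_order_gt0 zM). Qed.

(* The k-th and (-k)-th Fourier coefficients of u are conjugate; the combination
   with weights 1 and - q^(2k) eliminates the conjugate of b_k. *)
Lemma coef_le_defect k : (0 < k < N)%N ->
  M%:R * ((1 - q ^+ (4 * k)) * normc (b k)) <=
  2 * \sum_(j < M) u j * normc (1 - (q ^+ (2 * k))%:C * (z ^+ j) ^+ (2 * k)).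
Proof.
move=> kN; set x := q ^+ (2 * k).
have /andP[q0 q1] := q01.
have x1 : 0 < x < 1 by rewrite exprn_gt0//= exprn_ilt1 ?ltW//; lia.
have E1 := sum_defectV zM NM q C b c kN.
(* Since u is real, this is the conjugate of [E1]. *)
have E2 : \sum_(j < M) (u j)%:C * (z ^+ j) ^+ k =
    (- (M%:R / 2))%:C * ((c * b k)^*%C + x%:C * (c * b k)).
  transitivity (conjc (\sum_(j < M) (u j)%:C * (z ^+ j) ^- k)); last first.
    by rewrite E1; exact: conjc_affine.
  rewrite rmorph_sum; apply: eq_bigr => j _.
  transitivity ((u j)%:C * (((z ^+ j)^-1) ^+ k)^*%C); last first.
    by rewrite exprVn; exact/esym/conjc_realM.
  by rewrite rmorphXn /= -(conjc_unit (normc_prim_root_pow zM j)) conjcK.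
have E : \sum_(j < M) (u j)%:C * ((z ^+ j) ^- k - x%:C * (z ^+ j) ^+ k) =
    (- (M%:R / 2))%:C * ((1 - x ^+ 2)%:C * (c * b k)).
  under eq_bigr do rewrite mulrBr mulrCA.
  rewrite sumrB -mulr_sumr E1 E2 -/x.
  have -> : (1 - x ^+ 2)%:C = 1 - x%:C ^+ 2 :> R[i].
    by rewrite rmorphB rmorph1 rmorphXn.
  move: (c * b k)^*%C (c * b k) (x%:C) ((- _)%:C) => y' y x' s.
  by ring.
have -> : q ^+ (4 * k) = x ^+ 2 by rewrite -exprM; congr (_ ^+ _); lia.
have := congr1 (@normc R) E.
rewrite !normcM c1 mul1r !normc_real normrN !ger0_norm; last 2 first.
- by rewrite subr_ge0 expr_le1//; lra.
- by rewrite divr_ge0// ltW.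
move=> nE.
have : normc (\sum_(j < M) (u j)%:C * ((z ^+ j) ^- k - x%:C * (z ^+ j) ^+ k)) <=
    \sum_(j < M) u j * normc (1 - x%:C * (z ^+ j) ^+ (2 * k)).
  apply: le_trans (normc_sum_le _ _ _) _; apply: ler_sum => j _.
  rewrite normcM normc_real ger0_norm; last exact: defect_ge0.
  have zj1 := normc_prim_root_pow zM j.
  have zj0 := normc1_neq0 zj1.
  (* Pulling out a factor of modulus 1 leaves the kernel that occurs in [herglotz_term]. *)
  have -> : (z ^+ j) ^- k - x%:C * (z ^+ j) ^+ k =
      (z ^+ j) ^- k * (1 - x%:C * (z ^+ j) ^+ (2 * k)).
    by rewrite mul2n -addnn exprD; field; rewrite expf_neq0.
  by rewrite normcM normcV normcX zj1 expr1n invr1 mul1r.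
rewrite nE; lra.
Qed.

(** When [c * b k] is its own conjugate, the [k]-th Fourier coefficient of u is
    [- (1 + q ^+ (2 * k)) * (c * b k) / 2]; its modulus is at most the mean of u. *)
Lemma real_coef_le k : (0 < k < N)%N -> c * b k \is Num.real ->
  (1 + q ^+ (2 * k)) * normc (b k) <= 2 * (C - complex.Re (c * b 0%N)).
Proof.
move=> kN /complex_realP[y cby].
have E := sum_defectV zM NM q C b c kN.
have : normc (\sum_(j < M) (u j)%:C * (z ^+ j) ^- k) <= \sum_(j < M) u j.
  apply: le_trans (normc_sum_le _ _ _) _; apply: ler_sum => j _.
  rewrite normcM normc_real ger0_norm; last exact: defect_ge0.
  by rewrite normcV normcX (normc_prim_root_pow zM) expr1n invr1 mulr1.
rewrite (sum_defect zM NM)//; last by lia.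
rewrite E {1}cby [X in _ * X](_ : _ = (1 + q ^+ (2 * k))%:C * (c * b k)); last first.
  by rewrite cby rmorphD rmorph1 conjc_real; ring.
have x0 : 0 < q ^+ (2 * k) by rewrite exprn_gt0//; case/andP: q01.
rewrite !normcM c1 mul1r !normc_real normrN !ger0_norm; last 2 first.
- by lra.
- by rewrite divr_ge0// ltW.
rewrite -mulrA (_ : 2^-1 * _ = (1 + q ^+ (2 * k)) * normc (b k) / 2); last by ring.
rewrite ler_pM2l//; lra.
Qed.

End Coefs.

(** * The kernel inequality *)

Section Kernel.
Variable R : realType.
Implicit Types (q x : R) (e : R[i]).

(** Over all [k] these are the terms of the equation for R_1; over even [k] they form the first half
    of the equation for R_0. *)
Definition even_bohr_term q k : R := 4 * q ^+ k / (1 + q ^+ (2 * k)).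

(** The value of [herglotz_term] at e = i, where [e ^+ (2 * k)] is the sign of parity [k]. *)
Definition bohr_term q k : R :=
  if odd k then 4 * q ^+ k / (1 - q ^+ (2 * k)) else even_bohr_term q k.

(** The density against u in the bound for [2 * q ^+ k * normc (b k)]: the kernel of
    [coef_le_defect] times [4 * q ^+ k / (1 - q ^+ (4 * k))]. *)
Definition herglotz_term q e k : R :=
  4 * q ^+ k * normc (1 - (q ^+ (2 * k))%:C * e ^+ (2 * k)) / (1 - q ^+ (4 * k)).

(** This is |sin(m t)| <= m |sin t|, by induction with the addition formula. *)
Lemma Im_unitX e m : normc e = 1 -> `|complex.Im (e ^+ m)| <= m%:R * `|complex.Im e|.
Proof.
move=> e1; elim: m => [|m IH]; first by rewrite expr0 /= normr0 mul0r.
have ReIm (w : R[i]) : normc w = 1 -> `|complex.Re w| <= 1 /\ `|complex.Im w| <= 1.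
  case: w => s t /= <-; rewrite -!sqrtr_sqr !ler_wsqrtr// ?lerDl ?lerDr ?sqr_ge0//.
have em : normc (e ^+ m) = 1 by rewrite normcX e1 expr1n.
have [h1 h2] := ReIm _ e1; have [h3 h4] := ReIm _ em.
rewrite exprS; case: (e) (e ^+ m) h1 h2 h3 h4 IH => s t [s' t'] /= h1 h2 h3 h4 IH.
apply: le_trans (ler_normD _ _) _; rewrite !normrM -natr1 mulrDl mul1r lerD//.
  by apply: le_trans IH; rewrite ler_piMl.
by rewrite ler_piMr.
Qed.

(** With w of argument t: 1 - 2x cos(2t) + x^2, rewritten by cos(2t) = 1 - 2 sin(t)^2. The two sides
    differ by a multiple of |w|^2 - 1. *)
Lemma normc_one_sub_sqr x (w : R[i]) : normc w = 1 ->
  normc (1 - x%:C * w ^+ 2) ^+ 2 = (1 - x) ^+ 2 + 4 * x * complex.Im w ^+ 2.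
Proof.
case: w => s t /= st1.
have st : s ^+ 2 + t ^+ 2 = 1.
  by rewrite -[LHS]sqr_sqrtr ?addr_ge0 ?sqr_ge0// st1 expr1n.
rewrite sqr_sqrtr ?addr_ge0 ?sqr_ge0//.
apply/eqP; rewrite -subr_eq0.
rewrite [X in X == 0](_ : _ =
    (s ^+ 2 + t ^+ 2 - 1) * (x ^+ 2 * (s ^+ 2 + t ^+ 2 + 1) - 2 * x)); last by ring.
by rewrite st subrr mul0r.
Qed.

Lemma even_bohr_term_ge0 q k : 0 <= q -> 0 <= even_bohr_term q k.
Proof. by move=> q0; rewrite divr_ge0 ?mulr_ge0 ?addr_ge0 ?exprn_ge0. Qed.

Lemma bohr_term_ge0 q k : 0 <= q < 1 -> 0 <= bohr_term q k.
Proof.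
move=> /andP[q0 q1]; have x0 : 0 <= q ^+ (2 * k) by exact: exprn_ge0.
have x1 : q ^+ (2 * k) <= 1 by rewrite exprn_ile1// ltW.
rewrite /bohr_term /even_bohr_term; case: ifP => _;
  rewrite divr_ge0 ?mulr_ge0 ?exprn_ge0//; lra.
Qed.

(** By the triangle inequality the kernel is at most 1 + x with [x = q ^+ (2 * k)], and (1 + x) / (1
    - x^2) = 1 / (1 - x). *)
Lemma herglotz_term_odd q e k : 0 < q < 1 -> normc e = 1 -> odd k ->
  herglotz_term q e k <= bohr_term q k.
Proof.
move=> /andP[q0 q1] e1 ok; rewrite /herglotz_term /bohr_term ok.
set x := q ^+ (2 * k).
have k0 : (0 < k)%N by case: k ok @x.
have x0 : 0 < x by exact: exprn_gt0.
have x1 : x < 1 by rewrite exprn_ilt1 ?ltW// muln_eq0 -lt0n k0.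
have -> : q ^+ (4 * k) = x ^+ 2 by rewrite -exprM; congr (_ ^+ _); lia.
have n1 : normc (1 - x%:C * e ^+ (2 * k)) <= 1 + x.
  apply: le_trans (le_normcD _ _) _; rewrite normc1 normcN normcM normcX e1.
  by rewrite normc_real expr1n mulr1 gtr0_norm.
have p0 : 0 < 4 * q ^+ k by rewrite mulr_gt0// exprn_gt0.
rewrite -mulrA ler_pM2l// ler_pdivrMr; last by nra.
have -> : (1 - x)^-1 * (1 - x ^+ 2) = 1 + x by field; lra.
by [].
Qed.

(* The gain in this term away from e = i pays for the even terms, the only ones
   that are not maximal at e = i. *)
Lemma herglotz_term1 q e : 0 < q <= 4^-1 -> normc e = 1 ->
  herglotz_term q e 1 <= bohr_term q 1 - 4 * q ^+ 3 * complex.Re e ^+ 2.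
Proof.
move=> /andP[q0 q4] e1; rewrite /herglotz_term /bohr_term /even_bohr_term /= !muln1 expr1.
set x := q ^+ 2; set v := complex.Re e.
have x0 : 0 < x by exact: exprn_gt0.
have x4 : x <= 16^-1 by rewrite /x; nra.
have -> : q ^+ 4 = x ^+ 2 by rewrite -exprM.
have vs : v ^+ 2 + complex.Im e ^+ 2 = 1.
  rewrite /v; case: (e) e1 => s t /= st1.
  by rewrite -[LHS]sqr_sqrtr ?addr_ge0 ?sqr_ge0// st1 expr1n.
have n2 := normc_one_sub_sqr x e1; have n0 := normc_ge0 (1 - x%:C * e ^+ 2).
have v2 := sqr_ge0 v.
(* The square of the modulus is (1 + x)^2 - 4 x v^2; the square root lies below its tangent at (1 +
   x)^2. *)
have n1 : normc (1 - x%:C * e ^+ 2) <= 1 + x - 2 * x * v ^+ 2 / (1 + x).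
  have y0 : 0 <= 1 + x - 2 * x * v ^+ 2 / (1 + x).
    have : 2 * x * v ^+ 2 / (1 + x) <= 1.
      rewrite ler_pdivrMr; last lra. have := sqr_ge0 (complex.Im e). nra.
    lra.
  rewrite -(@ler_pXn2r _ 2) ?nnegrE// n2.
  have -> : (1 + x - 2 * x * v ^+ 2 / (1 + x)) ^+ 2 =
     (1 + x) ^+ 2 - 4 * x * v ^+ 2 + (2 * x * v ^+ 2 / (1 + x)) ^+ 2.
    by field; lra.
  have := sqr_ge0 (2 * x * v ^+ 2 / (1 + x)); nra.
have x2 : 0 < 1 - x ^+ 2 by nra.
apply: le_trans (_ : 4 * q * (1 + x - 2 * x * v ^+ 2 / (1 + x)) / (1 - x ^+ 2) <= _).
  by rewrite ler_pM2r ?invr_gt0// ler_pM2l//; lra.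
have -> : 4 * q * (1 + x - 2 * x * v ^+ 2 / (1 + x)) / (1 - x ^+ 2) =
    4 * q / (1 - x) - (4 * q ^+ 3 * v ^+ 2) * (2 / ((1 + x) * (1 - x ^+ 2))).
  by rewrite /x; field; rewrite -/x; lra.
have p0 : 0 <= 4 * q ^+ 3 * v ^+ 2 by rewrite mulr_ge0// mulr_ge0// exprn_ge0// ltW.
rewrite lerB// ler_peMr//.
rewrite ler_pdivlMr ?mulr_gt0//; [nra|lra].
Qed.

Lemma leq_sqr_exp4 k : ((k.+2) ^ 2 <= 4 ^ k.+1)%N.
Proof. by elim: k => // k IH; rewrite (expnS 4); lia. Qed.

(** The excess over the value at e = i is of order [q ^+ (3 * n)] times the square of Im e^n, with n
    = k + 2. Evenness of n makes Im e^n vanish with Re e, and the power of q outweighs the factor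
    n^2. *)
Lemma herglotz_term_even q e k : 0 < q <= 4^-1 -> normc e = 1 -> ~~ odd k ->
  herglotz_term q e k.+2 <=
  bohr_term q k.+2 + 16 * q ^+ 3 * complex.Re e ^+ 2 * 16^-1 ^+ k.+1.
Proof.
move=> /andP[q0 q4] e1 ok.
rewrite /herglotz_term /bohr_term /even_bohr_term /= negbK (negPf ok).
set n := k.+2.
have nE : n = (n./2 * 2)%N by rewrite muln2 even_halfK//= negbK.
set y := q ^+ n; set x := q ^+ (2 * n); set v := complex.Re e.
have y0 : 0 < y by exact: exprn_gt0.
have y1 : y <= 16^-1.
  rewrite /y /n !exprS mulrA; have : q ^+ k <= 1 by rewrite exprn_ile1 ?ltW//; lra.
  have : 0 <= q ^+ k by rewrite exprn_ge0 ?ltW. nra.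
have xy : x = y ^+ 2 by rewrite -exprM mulnC.
have x0 : 0 < x by exact: exprn_gt0.
have x4 : x <= 16^-1 by rewrite xy; nra.
have -> : q ^+ (4 * n) = x ^+ 2 by rewrite -exprM; congr (_ ^+ _); lia.
have en : normc (e ^+ n) = 1 by rewrite normcX e1 expr1n.
have n2 := normc_one_sub_sqr x en; set s := complex.Im (e ^+ n) in n2.
rewrite mulnC exprM; have n0 := normc_ge0 (1 - x%:C * e ^+ n ^+ 2).
have s2 := sqr_ge0 s.
have n1 : normc (1 - x%:C * e ^+ n ^+ 2) <= 1 - x + 2 * x * s ^+ 2 / (1 - x).
  have y2 : 0 <= 2 * x * s ^+ 2 / (1 - x).
    by rewrite divr_ge0//; [nra|lra].
  rewrite -(@ler_pXn2r _ 2) ?nnegrE//; last lra.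
  rewrite n2.
  have -> : (1 - x + 2 * x * s ^+ 2 / (1 - x)) ^+ 2 =
     (1 - x) ^+ 2 + 4 * x * s ^+ 2 + (2 * x * s ^+ 2 / (1 - x)) ^+ 2.
    by field; lra.
  have := sqr_ge0 (2 * x * s ^+ 2 / (1 - x)); nra.
have x2 : 0 < 1 - x ^+ 2 by nra.
apply: le_trans (_ : 4 * y * (1 - x + 2 * x * s ^+ 2 / (1 - x)) / (1 - x ^+ 2) <= _).
  by rewrite ler_pM2r ?invr_gt0// ler_pM2l//; lra.
have -> : 4 * y * (1 - x + 2 * x * s ^+ 2 / (1 - x)) / (1 - x ^+ 2) =
    4 * y / (1 + x) + (16 * y * x * s ^+ 2) * (2^-1 / ((1 - x) * (1 - x ^+ 2))).
  by field; lra.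
rewrite lerD2l; apply: le_trans (_ : 16 * y * x * s ^+ 2 <= _).
  rewrite ler_piMr//; first by rewrite mulr_ge0//; nra.
  by rewrite ler_pdivrMr ?mulr_gt0//; [nra|lra].
(* Writing e^n as a power of e^2 and using |Im e^2| = 2 |Re e| |Im e| gives |Im e^n| <= n |Re e|. *)
have sv : s ^+ 2 <= (n ^ 2)%:R * v ^+ 2.
  have E : e ^+ n = (e ^+ 2) ^+ n./2.
    by rewrite -exprM mulnC -nE.
  have e2 : normc (e ^+ 2) = 1 by rewrite normcX e1 expr1n.
  have : `|s| <= n./2%:R * (2 * `|v|).
    rewrite /s E; apply: le_trans (Im_unitX _ e2) _; rewrite ler_wpM2l//.
    rewrite /v; case: (e) e1 => a b /= ab1.
    have b1 : `|b| <= 1 by rewrite -ab1 -sqrtr_sqr ler_wsqrtr// lerDr sqr_ge0.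
    have -> : a * b + b * a = 2 * a * b by ring.
    by rewrite !normrM normr_nat ler_piMr// mulr_ge0.
  have -> : n./2%:R * (2 * `|v|) = n%:R * `|v|.
    rewrite {2}nE.
    by rewrite natrM mulrA.
  rewrite -(@ler_pXn2r _ 2) ?nnegrE// ?mulr_ge0//.
  by rewrite exprMn !real_normK ?num_real// natrX.
(* The growth [4 ^+ k.+1] of n^2 and the decay [64^-1 ^+ k.+1] of the power of q combine to the
   ratio 1/16. *)
have nk : (n ^ 2)%:R <= 4 ^+ k.+1 :> R by rewrite -natrX ler_nat leq_sqr_exp4.
have qk : q ^+ (3 * k.+1) <= 64^-1 ^+ k.+1.
  rewrite exprM lerXn2r ?nnegrE ?exprn_ge0 ?invr_ge0 ?(ltW q0)//.
  have -> : 64^-1 = 4^-1 ^+ 3 :> R by rewrite exprVn -natrX.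
  by rewrite lerXn2r ?nnegrE ?invr_ge0 ?(ltW q0).
have yxE : y * x = q ^+ 3 * q ^+ (3 * k.+1).
  by rewrite -!exprD; congr (_ ^+ _); rewrite /n; clear; lia.
have -> : 16 * y * x * s ^+ 2 = 16 * q ^+ 3 * (q ^+ (3 * k.+1) * s ^+ 2).
  by rewrite -[16 * y * x]mulrA yxE; ring.
rewrite -[X in _ <= X]mulrA ler_pM2l ?mulr_gt0 ?exprn_gt0//.
apply: le_trans (_ : 64^-1 ^+ k.+1 * (4 ^+ k.+1 * v ^+ 2) <= _).
  apply: ler_pM => //; first by rewrite exprn_ge0// ltW.
  apply: le_trans sv _.
  by rewrite ler_wpM2r ?sqr_ge0.
rewrite mulrA -exprMn mulrC (_ : 64^-1 * 4 = 16^-1 :> R)//; lra.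
Qed.

Lemma sum_herglotz_term q e K : 0 < q <= 4^-1 -> normc e = 1 ->
  \sum_(1 <= k < K) herglotz_term q e k <= \sum_(1 <= k < K) bohr_term q k.
Proof.
move=> q4 e1; case: K => [|[|K]]; [by rewrite !big_geq|by rewrite !big_geq|].
have /andP[q0 q4'] := q4; have q1 : 0 < q < 1 by rewrite q0/=; lra.
have g0 : 0 <= q ^+ 3 * complex.Re e ^+ 2.
  by rewrite mulr_ge0 ?sqr_ge0 ?exprn_ge0 ?ltW.
set g := q ^+ 3 * complex.Re e ^+ 2 in g0.
(* The first term saves 4g, the budget at K = 0. The even term of index K + 2 costs at most g
   16^(-K), while the budget drops by (15/8) g 16^(-K); odd terms cost nothing. *)
suff : \sum_(1 <= k < K.+2) herglotz_term q e k <=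
    \sum_(1 <= k < K.+2) bohr_term q k - g * (2 + 2 * 16^-1 ^+ K).
  have p0 : 0 <= g * (2 + 2 * 16^-1 ^+ K).
    by rewrite mulr_ge0// addr_ge0// mulr_ge0// exprn_ge0.
  by move=> h; apply: le_trans h _; rewrite gerBl.
elim: K => [|K IH].
  by rewrite !big_nat1 expr0; have := herglotz_term1 q4 e1; rewrite -mulrA -/g; lra.
rewrite !(@big_nat_recr _ _ _ K.+2)//= (exprS 16^-1).
have gp : 0 <= g * 16^-1 ^+ K by rewrite mulr_ge0// exprn_ge0.
have [ok|ok] := boolP (odd K).
  have := herglotz_term_odd (k := K.+2) q1 e1; rewrite /= negbK => /(_ ok).
  by move: gp IH; move: (16^-1 ^+ K) (\sum_(1 <= k < _) _) => p S1; lra.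
have := herglotz_term_even q4 e1 ok; rewrite (exprS 16^-1) -(mulrA 16) -/g.
by move: gp IH; move: (16^-1 ^+ K) (\sum_(1 <= k < _) _) => p S1; lra.
Qed.

End Kernel.

(** * Uniform bounds on the partial sums *)

Section Topology.
Variable R : realType.
Implicit Types (r q C : R) (z w : R[i]).

Lemma normc_norm z : `|z| = (normc z)%:C.
Proof. by case: z. Qed.

Lemma uniform_partial_sums r (f : R[i] -> R[i]) (a : nat -> R[i])
    (A : set R[i]^o) (eps : R) :
  faber_expansion r f a -> compact A -> A `<=` ellipse r -> 0 < eps ->
  exists N0, forall N, (N0 <= N)%N -> forall z, A z ->
    normc (f z - \sum_(0 <= n < N) a n * (faber r n).[z]) < eps.
Proof.
move=> fa cA Ae e0; have /= fA := fa A cA Ae.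
have e0C : 0 < eps%:C :> R[i] by rewrite ltcR.
have : nbhs (f : {uniform` A -> R[i]^o})
    [set h | forall z, A z -> `|f z - h z| < eps%:C].
  apply/uniform_nbhs; exists [set xy : R[i]^o * R[i]^o | `|xy.1 - xy.2| < eps%:C].
  split; last by [].
  rewrite -entourage_ballE; exists eps%:C => //=.
move=> /fA [N0 _ H]; exists N0 => N NN z Az.
by have := H N NN z Az; rewrite normc_norm ltcR.
Qed.

Lemma continuous_real_complex (x : R) :
  {for x, continuous (fun t : R => t%:C : R[i]^o)}.
Proof.
apply/cvgrPdist_lt => /= e e0.
have er : e = (complex.Re e)%:C.
  by rewrite RRe_real// realE ltW.
rewrite er in e0 *; rewrite ltcR in e0.
near=> t; rewrite -rmorphB/= normc_norm ltcR /= expr0n /= addr0 sqrtr_sqr.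
by near: t; move/cvgrPdist_lt : (@cvg_id R (nbhs x)); exact.
Unshelve. all: by end_near. Qed.

Lemma continuous_joukowski r z : z != 0 ->
  {for z, continuous (joukowski r : R[i]^o -> R[i]^o)}.
Proof.
move=> z0; have F : Filter (nbhs (z : R[i]^o)) by exact: nbhs_filter.
have cid := @cvg_id R[i]^o (nbhs (z : R[i]^o)).
have c1 := @cvgMr_tmp R[i] R[i]^o _ F _ _ (r%:C^-1) cid.
have c2 := @cvgMl_tmp R[i] R[i]^o _ F _ (r%:C) _ (@cvgV _ _ _ F _ _ z0 cid).
exact: (@cvgMl_tmp R[i] R[i]^o _ F _ 2^-1 _ (@cvgD _ _ _ _ F _ _ _ _ c1 c2)).
Qed.

(** The circle is the union of the graphs of [sqrt (rho ^+ 2 - x ^+ 2)] and its negative over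
    [[-rho, rho]], so its image is a union of two continuous images of a segment. *)
Lemma compact_joukowski_circle r (rho : R) : 0 < rho ->
  compact ([set joukowski r w | w in [set w | normc w = rho]] : set R[i]^o).
Proof.
move=> rho0.
pose c (s x : R) : R[i]^o :=
  x%:C + s%:C * 'i%C * (Num.sqrt (rho ^+ 2 - x ^+ 2))%:C.
pose h (s x : R) : R[i]^o := joukowski r (c s x).
have Eh s x : c s x = x +i* (s * Num.sqrt (rho ^+ 2 - x ^+ 2)).
  by rewrite /c /real_complex_def/=; simpc.
have nh s x : s ^+ 2 = 1 -> x \in `[-rho, rho] ->
    normc (c s x) = rho.
  move=> s1; rewrite Eh in_itv/= -ler_norml => xr.
  rewrite exprMn s1 mul1r sqr_sqrtr; last first.
    by rewrite subr_ge0 -real_normK ?num_real// lerXn2r// nnegrE// ltW.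
  by rewrite addrC subrK sqrtr_sqr gtr0_norm.
have ch s : s ^+ 2 = 1 -> compact (h s @` `[-rho, rho] : set R[i]^o).
  move=> s1; apply: continuous_compact; last exact: segment_compact.
  apply: continuous_in_subspaceT => x; rewrite inE => xr.
  apply: (@continuous_comp R R[i]^o R[i]^o (c s) (joukowski r)).
    have F : Filter (nbhs x) by exact: nbhs_filter.
    have c1 : rho ^+ 2 - t ^+ 2 @[t --> x] --> rho ^+ 2 - x ^+ 2.
      by apply: cvgB; [exact: cvg_cst|exact: exprn_continuous].
    have c2 := cvg_comp _ _ c1 (@sqrt_continuous R _).
    have c3 := cvg_comp _ _ c2 (@continuous_real_complex _).
    have c4 := @cvgMl_tmp R[i] R _ F _ (s%:C * 'i%C) _ c3.
    exact: (@cvgD _ _ _ _ F _ _ _ _ (@continuous_real_complex x) c4).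
  apply: continuous_joukowski; apply/eqP => x0.
  by have := nh s x s1 xr; rewrite x0 normc0 => r0; rewrite r0 ltxx in rho0.
rewrite (_ : [set _ | _ in _] = h 1 @` `[-rho, rho] `|` h (-1) @` `[-rho, rho]).
  by apply: compactU; apply: ch; rewrite ?sqrrN expr1n.
apply/seteqP; split => [_ [[x y] /= xy <-]|_ [|] /= [x xr <-]].
- have xy2 : x ^+ 2 + y ^+ 2 = rho ^+ 2.
    by rewrite -xy sqr_sqrtr// addr_ge0 ?sqr_ge0.
  have xr : `[-rho, rho]%classic x.
    rewrite /= in_itv /= -ler_norml -(@ler_pXn2r _ 2) ?nnegrE ?normr_ge0 ?(ltW rho0)//.
    by rewrite real_normK ?num_real// -xy2 lerDl sqr_ge0.
  have sy : Num.sqrt (rho ^+ 2 - x ^+ 2) = `|y|.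
    by rewrite -xy2 addrAC subrr add0r sqrtr_sqr.
  have [y0|y0] := leP 0 y; [left|right]; exists x => //; rewrite /h Eh sy.
    by rewrite ger0_norm// mul1r.
  by rewrite ltr0_norm// mulN1r opprK.
- by eexists; [|reflexivity]; apply: nh => //; rewrite expr1n.
- by eexists; [|reflexivity]; apply: nh => //; rewrite sqrrN expr1n.
Qed.

(** Since r < r / q < 1, the image of the circle is a compact subset of the ellipse; there |f| < 1
    and the partial sums are eventually within [C - 1] of f. *)
Lemma partial_sum_bound r q C (f : R[i] -> R[i]) (a : nat -> R[i]) :
  0 < r < q -> q < 1 -> 1 < C -> faber_expansion r f a ->
  (forall z, ellipse r z -> normc (f z) < 1) ->
  exists N0, forall N, (N0 <= N)%N -> forall w, normc w = r / q ->
    normc (\sum_(0 <= n < N) a n * (faber r n).[joukowski r w]) <= C.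
Proof.
move=> /andP[r0 rq] q1 C1 fa f1; have q0 := lt_trans r0 rq.
have rq0 : 0 < r / q by rewrite divr_gt0.
have sub : [set joukowski r w | w in [set w | normc w = r / q]] `<=` ellipse r.
  move=> _ [w /= nw <-]; right; exists w => //=; rewrite nw.
  by rewrite ltr_pdivlMr// ltr_pdivrMr// mul1r rq andbT gtr_pMr.
have [|N0 H] := uniform_partial_sums fa (compact_joukowski_circle (r := r) rq0) sub
  (_ : 0 < C - 1); first by rewrite subr_gt0.
exists N0 => N /H {}H w nw; set z := joukowski r w.
have Az : [set joukowski r w | w in [set w | normc w = r / q]] z by exists w.
set S := \sum_(_ <= _ < _) _.
have -> : S = f z + (- (f z - S)) by rewrite opprB addrC subrK.
apply: le_trans (le_normcD _ _) _; rewrite normcN.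
have := H z Az; have := f1 z (sub z Az); rewrite -/S; lra.
Qed.

End Topology.

(** * Passage to one-sided limits and continuity of the finite sums *)

Section Limits.
Variable R : realType.
Implicit Types (q r : R).

Lemma ge_at_continuous (g : R -> R) (x A : R) : {for x, continuous g} ->
  (forall e, 0 < e -> exists2 y, `|x - y| < e & A <= g y) -> A <= g x.
Proof.
move=> cg H; rewrite leNgt; apply/negP => gA.
have gA' : 0 < A - g x by rewrite subr_gt0.
move/cvgrPdist_lt : cg => /(_ _ gA') [e /= e0 He].
have [y /He /=] := H e e0.
by rewrite ltr_norml => /andP[]; lra.
Qed.

Lemma ge_at_right_limit (g : R -> R) (x s A : R) : x < s -> {for x, continuous g} ->
  (forall y, x < y < s -> A <= g y) -> A <= g x.
Proof.
move=> xs cg H; apply: ge_at_continuous cg _ => e e0.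
pose d := Num.min (e / 2) ((s - x) / 2).
have d0 : 0 < d by rewrite lt_min !divr_gt0 ?subr_gt0.
have de : d <= e / 2 by rewrite ge_min lexx.
have ds : d <= (s - x) / 2 by rewrite ge_min lexx orbT.
exists (x + d); first by rewrite opprD addrA subrr add0r normrN gtr0_norm//; lra.
by apply: H; apply/andP; split; lra.
Qed.

Lemma ge_at_left_limit (g : R -> R) (x s A : R) : s < x -> {for x, continuous g} ->
  (forall y, s < y < x -> A <= g y) -> A <= g x.
Proof.
move=> xs cg H; apply: ge_at_continuous cg _ => e e0.
pose d := Num.min (e / 2) ((x - s) / 2).
have d0 : 0 < d by rewrite lt_min !divr_gt0 ?subr_gt0.
have de : d <= e / 2 by rewrite ge_min lexx.
have ds : d <= (x - s) / 2 by rewrite ge_min lexx orbT.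
exists (x - d); first by rewrite subKr gtr0_norm//; lra.
by apply: H; apply/andP; split; lra.
Qed.

Lemma continuous_bohr_term k r : 0 < r < 1 -> (0 < k)%N ->
  {for r, continuous (fun q => bohr_term q k)}.
Proof.
move=> /andP[r0 r1] k0; rewrite /bohr_term /even_bohr_term.
have cn n : (fun q : R => q ^+ n) x @[x --> r] --> r ^+ n by exact: exprn_continuous.
have x1 : r ^+ (2 * k) < 1 by rewrite exprn_ilt1 ?ltW// muln_eq0 -lt0n k0.
have x0 : 0 <= r ^+ (2 * k) by rewrite exprn_ge0// ltW.
case: (odd k).
  apply: cvgM; first by apply: cvgM; [exact: cvg_cst|exact: cn].
  by apply: cvgV; [lra|apply: cvgB; [exact: cvg_cst|exact: cn]].
apply: cvgM; first by apply: cvgM; [exact: cvg_cst|exact: cn].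
by apply: cvgV; [lra|apply: cvgD; [exact: cvg_cst|exact: cn]].
Qed.

Lemma continuous_even_bohr_term k r :
  {for r, continuous (fun q => even_bohr_term q k)}.
Proof.
rewrite /even_bohr_term.
have cn n : (fun q : R => q ^+ n) x @[x --> r] --> r ^+ n by exact: exprn_continuous.
apply: cvgM; first by apply: cvgM; [exact: cvg_cst|exact: cn].
apply: cvgV; last by apply: cvgD; [exact: cvg_cst|exact: cn].
by rewrite gt_eqF// ltr_pwDl// mulnC exprM sqr_ge0.
Qed.

Lemma continuous_sum (g : R -> nat -> R) K r :
  (forall k, (0 < k)%N -> {for r, continuous (fun q => g q k)}) ->
  {for r, continuous (fun q => \sum_(1 <= k < K) g q k)}.
Proof.
move=> cg; elim: K => [|K IH].
  rewrite (_ : (fun q => _) = fun=> 0); first exact: cvg_cst.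
  by apply/funext => q; rewrite big_geq.
case: K IH => [|K] IH.
  rewrite (_ : (fun q => _) = fun=> 0); first exact: cvg_cst.
  by apply/funext => q; rewrite big_geq.
rewrite (_ : (fun q => _) = fun q => \sum_(1 <= k < K.+1) g q k + g q K.+1).
  by apply: cvgD; [exact: IH|exact: cg].
by apply/funext => q; rewrite big_nat_recr.
Qed.

Lemma ler_sum_nat_widen (u : nat -> R) m K L :
  (forall k, (m <= k)%N -> 0 <= u k) -> (K <= L)%N ->
  \sum_(m <= k < K) u k <= \sum_(m <= k < L) u k.
Proof.
move=> u0 KL; have pos n : (m <= n)%N -> 0 <= \sum_(n <= k < L) u k.
  move=> mn; rewrite big_nat_cond sumr_ge0// => k /andP[/andP[nk _] _].
  by rewrite u0// (leq_trans mn).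
have [mK|Km] := leqP m K; last by rewrite big_geq ?pos// ltnW.
by rewrite [X in _ <= X](big_cat_nat (n := K))//= lerDl pos.
Qed.

End Limits.

(** * Faber coefficients of a function bounded by 1 *)

Section FaberCoefficients.
Variable R : realType.
Variables (r : R) (f : R[i] -> R[i]) (a : nat -> R[i]).
Hypotheses (r0 : 0 < r) (fa : faber_expansion r f a)
  (f1 : forall z, ellipse r z -> normc (f z) < 1).
Implicit Types (q C : R) (w : R[i]).

Lemma faber_scale q n w : 0 < q -> w != 0 ->
  (faber r n).[joukowski r ((r / q)%:C * w)] =
  ((r / q) ^+ n)%:C * laurent_faber q n w.
Proof.
move=> q0 w0; case: n => [|n]; first by rewrite expr0 mul1r hornerC.
have qC : q%:C != 0 :> R[i] by rewrite (inj_eq (@complexI R)) gt_eqF.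
have rC : r%:C != 0 :> R[i] by rewrite (inj_eq (@complexI R)) gt_eqF.
rewrite faber_joukowski//; last first.
  by rewrite mulf_neq0// (inj_eq (@complexI R)) gt_eqF// divr_gt0.
have E : r ^+ (2 * n.+1) = (r / q) ^+ n.+1 * q ^+ (2 * n.+1) * (r / q) ^+ n.+1.
  rewrite mulrAC -exprD addnn -mul2n -exprMn divfK// gt_eqF//.
rewrite /laurent_faber exprMn mulrDr -rmorphXn; congr (_ + _).
rewrite E !rmorphM /= invfM; set s := ((r / q) ^+ n.+1)%:C.
have s0 : s != 0.
  by rewrite (inj_eq (@complexI R)) expf_neq0// mulf_neq0 ?invr_eq0 ?gt_eqF.
by field; rewrite s0 expf_neq0.
Qed.

(** The realness clause keeps the rotated coefficients [c * b k] real in the case of real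
    coefficients. *)
Lemma exists_rotation (a0 : R[i]) : exists c, [/\ normc c = 1,
  c * a0 = (normc a0)%:C & a0 \is Num.real -> c \is Num.real].
Proof.
have [->|a00] := eqVneq a0 0.
  by exists 1; rewrite normc1 normc0 mulr0; split=> // _; exact: real1.
have n0 : normc a0 != 0 by apply: contra_neq a00 => /eq0_normc.
exists (a0^*%C / (normc a0)%:C); split.
- by rewrite normcM normcV normc_conj normc_real ger0_norm ?normc_ge0// divff.
- rewrite mulrAC mulJc expr2 rmorphM mulfK//.
  by rewrite (inj_eq (@complexI R)).
- move=> /complex_realP[x ->]; rewrite conjc_real -fmorphV -rmorphM.
  by apply/complex_realP; eexists.
Qed.

(* Scaling w by r / q identifies a smaller confocal ellipse, on which the
   partial sums are uniformly close to f, with the ellipse of parameter q. *)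
Definition scaled_coef q n : R[i] := a n * ((r / q) ^+ n)%:C.

Lemma normc_scaled_coef q n : 0 < q ->
  normc (scaled_coef q n) = normc (a n) * (r / q) ^+ n.
Proof.
move=> q0; rewrite normcM normc_real ger0_norm// exprn_ge0// ltW// divr_gt0//.
Qed.

Lemma laurent_sum_scaled_coef_bound q C K : r < q < 1 -> 1 < C ->
  exists N M z, [/\ (K <= N)%N, (0 < N)%N, (2 * N <= M)%N, M.-primitive_root z &
    forall j, normc (laurent_sum N q (scaled_coef q) (z ^+ j)) <= C].
Proof.
move=> /andP[rq q1] C1; have q0 := lt_trans r0 rq.
have [|N0 H] := partial_sum_bound _ q1 C1 fa f1; first by rewrite r0.
(* Large enough for the uniform bound and for all indices below [K]; the successor makes it
   positive. Taking [M] to be [2 * N] makes the discrete means exact. *)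
pose N := (maxn N0 K).+1.
have [z zM] := @prim_root_complex R (2 * N)%N (ltac:(lia)).
exists N, (2 * N)%N, z; split=> //; first by rewrite /N; lia.
move=> j; have zj := normc_prim_root_pow zM j.
have zj0 := normc1_neq0 zj.
have N0N : (N0 <= N)%N by rewrite /N; lia.
have nw : normc ((r / q)%:C * z ^+ j) = r / q.
  by rewrite normcM normc_real zj mulr1 ger0_norm// ltW// divr_gt0.
have := H N N0N _ nw.
rewrite /laurent_sum; congr (normc _ <= _); apply: eq_bigr => n _.
by rewrite faber_scale// mulrA.
Qed.

(** With y = |a_k|: the weight [q ^+ k] undoes the scaling, as q^k |b_k| = r^k |a_k|. *)
Lemma mul_scaled_weight q k (y : R) : 0 < q ->
  q ^+ k * (y * (r / q) ^+ k) = r ^+ k * y.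
Proof.
move=> q0; rewrite mulrCA -exprMn mulrCA divff ?gt_eqF// mulr1 mulrC.
by [].
Qed.

(** Times [M], each term is at most the sum of u against [herglotz_term]. After exchanging the sums,
    the kernel inequality applies at each root of unity separately, and the total mass of u
    remains. *)
Lemma sum_coef_le q C K : r < q -> q <= 4^-1 -> 1 < C ->
  \sum_(1 <= k < K) 2 * r ^+ k * normc (a k) <=
  (C - normc (a 0%N)) * \sum_(1 <= k < K) bohr_term q k.
Proof.
move=> rq q4 C1; have q0 := lt_trans r0 rq.
have q1 : q < 1 by lra.
have [|N [M [z [KN N0 NM zM LC]]]] := @laurent_sum_scaled_coef_bound q C K _ C1.
  by rewrite rq.
have [c [c1 ca _]] := exists_rotation (a 0%N).
pose u := defect N z q C (scaled_coef q) c.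
have M0 : 0 < M%:R :> R by rewrite ltr0n (prim_order_gt0 zM).
have su : \sum_(j < M) u j = M%:R * (C - normc (a 0%N)).
  by rewrite /u (sum_defect zM NM)// /scaled_coef expr0 mulr1 ca.
rewrite -(ler_pM2l M0) mulrA -su mulr_suml mulr_sumr.
apply: le_trans (_ : \sum_(1 <= k < K) \sum_(j < M) u j *
    herglotz_term q (z ^+ j) k <= _).
  apply: ler_sum_nat => k /andP[k0 kK].
  have kN : (0 < k < N)%N by rewrite k0 (leq_trans kK).
  have q01 : 0 < q < 1 by rewrite q0.
  have := coef_le_defect zM NM q01 c1 LC kN; rewrite normc_scaled_coef//.
  have d0 : 0 < 1 - q ^+ (4 * k).
    by rewrite subr_gt0 exprn_ilt1 ?ltW// muln_eq0 -lt0n k0.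
  have w0 : 0 < 2 * q ^+ k / (1 - q ^+ (4 * k)).
    by rewrite divr_gt0// mulr_gt0// exprn_gt0.
  move=> /(ler_wpM2l (ltW w0)).
  have E (A D m X : R) : D != 0 -> 2 * A / D * (m * (D * X)) = m * (2 * (A * X)).
    by move=> D0; field.
  rewrite E ?gt_eqF//.
  rewrite mul_scaled_weight// (mulrA 2) => h; apply: le_trans h _.
  rewrite -mulrA mulr_sumr le_eqVlt; apply/orP; left; apply/eqP.
  rewrite !mulr_sumr; apply: eq_bigr => j _; rewrite /herglotz_term -/u.
  by field; rewrite gt_eqF.
rewrite exchange_big /=; apply: ler_sum => j _; rewrite -mulr_sumr.
rewrite ler_wpM2l//; first exact: defect_ge0.
apply: sum_herglotz_term; first by rewrite q0.
exact: normc_prim_root_pow zM j.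
Qed.

Lemma sum_real_coef_le q C K : (forall n, a n \is Num.real) ->
  r < q -> q < 1 -> 1 < C ->
  \sum_(1 <= k < K) 2 * r ^+ k * normc (a k) <=
  (C - normc (a 0%N)) * \sum_(1 <= k < K) even_bohr_term q k.
Proof.
move=> ar rq q1 C1; have q0 := lt_trans r0 rq.
have [|N [M [z [KN N0 NM zM LC]]]] := @laurent_sum_scaled_coef_bound q C K _ C1.
  by rewrite rq.
have [c [c1 ca cr]] := exists_rotation (a 0%N).
rewrite mulr_sumr; apply: ler_sum_nat => k /andP[k0 kK].
have kN : (0 < k < N)%N by rewrite k0 (leq_trans kK).
have q01 : 0 < q < 1 by rewrite q0.
have bkr : c * scaled_coef q k \is Num.real.
  rewrite realM ?cr// realM ?ar//.
  by apply/complex_realP; eexists.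
have := real_coef_le zM NM q01 c1 LC kN bkr.
rewrite normc_scaled_coef// [scaled_coef q 0]/scaled_coef expr0 mulr1 ca /=.
have d0 : 0 < 1 + q ^+ (2 * k) by rewrite ltr_pwDl// exprn_ge0// ltW.
have w0 : 0 < 2 * q ^+ k / (1 + q ^+ (2 * k)).
  by rewrite divr_gt0// mulr_gt0// exprn_gt0.
move=> /(ler_wpM2l (ltW w0)).
have E (A D X : R) : D != 0 -> 2 * A / D * (D * X) = 2 * (A * X).
  by move=> D0; field.
rewrite E ?gt_eqF//.
rewrite mul_scaled_weight// (mulrA 2) => h; apply: le_trans h _.
rewrite le_eqVlt; apply/orP; left; apply/eqP.
by rewrite /even_bohr_term; field; rewrite gt_eqF.
Qed.

Lemma sum_sqr_coef_le K : r < 1 -> \sum_(0 <= k < K) normc (a k) ^+ 2 <= 1.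
Proof.
move=> r1.
have H q C : r < q < 1 -> 1 < C ->
    \sum_(0 <= k < K) normc (a k) ^+ 2 * (r / q) ^+ (2 * K) <= C ^+ 2.
  move=> rq1 C1; have /andP[rq q1] := rq1; have q0 := lt_trans r0 rq.
  have [N [M [z [KN N0 NM zM LC]]]] := @laurent_sum_scaled_coef_bound q C K rq1 C1.
  apply: le_trans (bessel zM NM LC).
  apply: le_trans (ler_sum_nat_widen _ KN); last by move=> i _; exact: sqr_ge0.
  (* As r / q < 1, the common exponent [2 * K] bounds every scaling factor from below. *)
  apply: ler_sum_nat => k /andP[_ kK].
  rewrite normc_scaled_coef// [X in _ <= X]exprMn -exprM ler_wpM2l ?sqr_ge0// mulnC.
  have rq0 : 0 <= r / q by rewrite ltW// divr_gt0.
  rewrite ler_wiXn2l//; first by rewrite ler_pdivrMr// mul1r ltW.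
  by rewrite leq_mul2r ltnW ?orbT.
have {}H C : 1 < C -> \sum_(0 <= k < K) normc (a k) ^+ 2 <= C ^+ 2.
  move=> C1.
  (* The factor 1 is written as [(r / r) ^+ (2 * K)] to exhibit the value at [q = r] of a function
     continuous in [q]. *)
  rewrite -[X in X <= _]mulr1 -[X in _ * X](expr1n _ (2 * K)).
  rewrite -[X in X ^+ (2 * K)](divff (lt0r_neq0 r0)).
  set A := \sum_(_ <= _ < _) _.
  suff : 0 <= C ^+ 2 - A * (r / r) ^+ (2 * K) by rewrite subr_ge0.
  apply: (@ge_at_right_limit _ (fun q => C ^+ 2 - A * (r / q) ^+ (2 * K)) r 1) => //.
    apply: cvgB; first exact: cvg_cst.
    apply: cvgM; first exact: cvg_cst.
    have c1 : r / q @[q --> r] --> r / r.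
      by apply: cvgM; [exact: cvg_cst|apply: cvgV => //; rewrite gt_eqF].
    exact: (cvg_comp _ _ c1 (@exprn_continuous R _ _)).
  by move=> q rq; rewrite subr_ge0 mulr_suml; exact: H.
rewrite -[X in _ <= X](expr1n _ 2).
apply: (@ge_at_right_limit _ (fun C => C ^+ 2) 1 2) => //; first by rewrite ltr1n.
  exact: exprn_continuous.
by move=> C /andP[C1 _]; exact: H.
Qed.

(** If |a_0| >= 1, Bessel forces every other coefficient to vanish; then the nonempty partial sums
    at 0 all equal a_0, which contradicts |f(0)| < 1. *)
Lemma normc_coef0_lt1 : r < 1 -> normc (a 0%N) < 1.
Proof.
move=> r1; rewrite ltNge; apply/negP => a1.
have ak k : (0 < k)%N -> a k = 0.
  move=> k0; apply: eq0_normc; apply/eqP; rewrite -sqrf_eq0.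
  have := sum_sqr_coef_le k.+1 r1; rewrite big_nat_recl//.
  rewrite (bigD1_seq k.-1) ?mem_index_iota ?iota_uniq//=; last by lia.
  rewrite prednK//; set S := \sum_(_ <- _ | _) _.
  have S0 : 0 <= S by apply: sumr_ge0 => i _; exact: sqr_ge0.
  have h0 : 1 <= normc (a 0%N) ^+ 2 by rewrite expr_ge1// normc_ge0.
  have hk := sqr_ge0 (normc (a k)).
  by move=> h; apply/eqP; apply/le_anti/andP; split=> //; lra.
have e0 : ellipse r 0 by left; exists 0 => //=; rewrite in_itv/=; lra.
have h := f1 e0.
have sub : [set (0 : R[i]^o)] `<=` ellipse r by move=> _ ->.
have pos : 0 < 1 - normc (f 0) by rewrite subr_gt0.
have [N0 /(_ N0.+1 (leqnSn _) 0 erefl)] :=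
  uniform_partial_sums fa (@compact_set1 _ (0 : R[i]^o)) sub pos.
rewrite big_nat_recl//= hornerC mulr1 big1_seq ?addr0; last first.
  by move=> i _; rewrite ak// mul0r.
have := le_normcD (a 0%N - f 0) (f 0);
rewrite subrK -[X in normc X + _]opprB normcN; lra.
Qed.

(** A bound uniform in [K] is needed, since strictness of each partial sum would not survive the
    limit. *)
Lemma bohr_partial_sum_lt1 (t : nat -> R) : r < 1 ->
  (forall k, (0 < k)%N -> 2 * r ^+ k <= t k) ->
  (forall K, \sum_(1 <= k < K) t k <= 1) ->
  (forall K, \sum_(1 <= k < K) 2 * r ^+ k * normc (a k) <=
     (1 - normc (a 0%N)) * \sum_(1 <= k < K) t k) ->
  exists2 d, d < 1 & forall K,
    normc (a 0%N) + \sum_(1 <= k < K) 2 * r ^+ k * normc (a k) <= d.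
Proof.
move=> r1 tr t1 H; set al := normc (a 0%N) in H *.
have al1 : 0 < 1 - al by rewrite subr_gt0 normc_coef0_lt1.
have [n0 [n00 Hn0]] : exists n0, (0 < n0)%N /\
    forall n, (n0 <= n)%N -> normc (a n) <= (1 - al) / 2.
  have cs : cvgn (series (fun k => normc (a k) ^+ 2)).
    apply: nondecreasing_is_cvgn.
      by apply: nondecreasing_series => k _ _; exact: sqr_ge0.
    by exists 1 => _ [n _ <-]; exact: sum_sqr_coef_le.
  have e0 : 0 < ((1 - al) / 2) ^+ 2 by rewrite exprn_gt0// divr_gt0.
  have /cvgrPdist_lt /(_ _ e0) [n0 _ h] := cvg_series_cvg_0 cs.
  exists n0.+1; split=> // n nn; have := h n (ltnW nn).
  rewrite sub0r normrN ger0_norm ?sqr_ge0//.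
  have d0 : 0 <= (1 - al) / 2 by lra.
  by move=> h2; apply/ltW; rewrite -(@ltr_pXn2r _ 2) ?nnegrE ?normc_ge0.
(* The saving comes from index [n0] alone: there 2 r^n0 |a_n0| <= (1 - al) r^n0, while
   [(1 - al) * t n0] is at least twice that. *)
exists (1 - (1 - al) * r ^+ n0).
  by rewrite ltrBlDr ltrDl mulr_gt0// exprn_gt0.
move=> K.
(* The range is extended so that it contains the index [n0]. *)
apply: le_trans (_ : al + \sum_(1 <= k < K + n0.+1) 2 * r ^+ k * normc (a k) <= _).
  rewrite lerD2l ler_sum_nat_widen ?leq_addr// => k _.
  by rewrite !mulr_ge0 ?normc_ge0 ?exprn_ge0 ?(ltW r0).
rewrite addnS (big_cat_nat (n := n0))//=; last by rewrite -addnS; lia.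
have := H n0.
have : \sum_(n0 <= k < (K + n0).+1) 2 * r ^+ k * normc (a k) <=
    (1 - al) * (\sum_(n0 <= k < (K + n0).+1) t k - r ^+ n0).
  have n0K : (n0 <= K + n0)%N by rewrite leq_addl.
  rewrite !(big_ltn (m := n0))//.
  rewrite [t n0 + _ - _]addrAC [X in _ <= X]mulrDr.
  apply: lerD.
    have := Hn0 n0 (leqnn _); have := tr n0 n00.
    have : 0 < r ^+ n0 by rewrite exprn_gt0.
    move: (r ^+ n0) (normc _) => x y *; nra.
  rewrite mulr_sumr; apply: ler_sum_nat => k /andP[kn _].
  have := Hn0 k (ltnW kn); have := tr k (ltac:(lia)).
  have : 0 < r ^+ k by rewrite exprn_gt0.
  move: (r ^+ k) (normc _) => x y *; nra.
have := t1 (K + n0).+1; rewrite (big_cat_nat (n := n0))//=; last by lia.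
move: (\sum_(1 <= _ < n0) t _) (\sum_(n0 <= _ < _) t _) => T1 T2.
move=> T h1 h2.
have : (1 - al) * (T1 + T2) <= 1 - al by rewrite ler_piMr// ltW.
lra.
Qed.

End FaberCoefficients.

(** * The equations defining R_0 and R_1 *)

Section SeriesRoot.
Variable R : realType.

Lemma nneseries_le (u : nat -> R) n (d : R) : (forall k, (n <= k)%N -> 0 <= u k) ->
  (\sum_(n <= k <oo) (u k)%:E <= d%:E)%E <-> (forall K, \sum_(n <= k < K) u k <= d).
Proof.
move=> u0; split=> [h K|h].
  rewrite -lee_fin -sumEFin; apply: le_trans h.
  by apply: nneseries_lim_ge => k nk _; rewrite lee_fin u0.
apply: lime_le.
  by apply: is_cvg_nneseries => k nk _; rewrite lee_fin u0.
by apply: nearW => K; rewrite sumEFin lee_fin.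
Qed.

(** States the equation as a least upper bound of finite sums, so that later arguments stay among
    real numbers. *)
Lemma nneseries_eq1 (u : nat -> R) : (forall k, (0 < k)%N -> 0 <= u k) ->
  (\sum_(1 <= k <oo) (u k)%:E = 1)%E <->
  (forall K, \sum_(1 <= k < K) u k <= 1) /\
  (forall d, (forall K, \sum_(1 <= k < K) u k <= d) -> 1 <= d).
Proof.
move=> u0; have H d := nneseries_le (n := 1) d u0; split=> [u1|[h1 h2]].
  by split=> [|d /H]; [apply/H; rewrite u1|rewrite u1 lee_fin].
apply/le_anti/andP; split; first exact/H.
have : (0 <= \sum_(1 <= k <oo) (u k)%:E)%E.
  by apply: nneseries_ge0 => k k1 _; rewrite lee_fin u0.
case E : (\sum_(1 <= k <oo) (u k)%:E)%E => [d||]// _; last by rewrite leey.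
by rewrite lee_fin; apply: h2; apply/H; rewrite E.
Qed.

(** Stands for both [bohr_term] and [even_bohr_term]. The bound [t_le] gives a geometric tail
    uniform in q, and [t_quarter] forces a root below 1/4. *)
Variable t : R -> nat -> R.
Hypotheses
  (t0 : forall q k, 0 < q < 1 -> (0 < k)%N -> 0 <= t q k)
  (t_incr : forall p q k, 0 < p < q -> q < 1 -> (0 < k)%N -> t p k < t q k)
  (t_cont : forall q k, 0 < q < 1 -> (0 < k)%N -> {for q, continuous (t ^~ k)})
  (t_le : forall q k, 0 < q <= 4^-1 -> (0 < k)%N -> t q k <= 8 * q ^+ k)
  (t_quarter : 1 < t 4^-1 1 + t 4^-1 2).

Lemma series_root_sum_le p q K : 0 < p <= q -> q < 1 ->
  \sum_(1 <= k < K) t p k <= \sum_(1 <= k < K) t q k.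
Proof.
move=> /andP[p0]; rewrite le_eqVlt => /orP[/eqP->//|pq q1].
by apply: ler_sum_nat => k /andP[k0 _]; apply/ltW/t_incr => //; rewrite p0.
Qed.

Lemma series_root_lt r : 0 < r < 1 -> (\sum_(1 <= k <oo) (t r k)%:E = 1)%E ->
  r < 4^-1.
Proof.
move=> r01 /nneseries_eq1[k k0|/(_ 3) h _]; first exact: t0.
rewrite ltNge; apply/negP => r4; have /andP[r0 r1] := r01.
have : \sum_(1 <= k < 3) t 4^-1 k <= 1.
  by apply: le_trans h; apply: series_root_sum_le => //; rewrite invr_gt0 r4 ltr0n.
by rewrite big_nat_recr//= big_nat1 leNgt t_quarter.
Qed.

(** The strict increase of the first term keeps all partial sums at [p] a fixed amount below 1. *)
Lemma series_root_inj p q : 0 < p -> p < q -> q < 1 ->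
  (\sum_(1 <= k <oo) (t p k)%:E = 1)%E -> (\sum_(1 <= k <oo) (t q k)%:E = 1)%E ->
  False.
Proof.
move=> p0 pq q1 Sp Sq; have p1 := lt_trans pq q1; have q0 := lt_trans p0 pq.
have tp k : (0 < k)%N -> 0 <= t p k by apply: t0; rewrite p0.
have tq k : (0 < k)%N -> 0 <= t q k by apply: t0; rewrite q0.
have [_ hp] := (nneseries_eq1 tp).1 Sp; have [hq _] := (nneseries_eq1 tq).1 Sq.
have d0 : t p 1 < t q 1 by apply: t_incr => //; rewrite p0.
have /hp : forall K, \sum_(1 <= k < K) t p k <= 1 - (t q 1 - t p 1); last lra.
move=> K.
apply: le_trans (_ : \sum_(1 <= k < K.+2) t p k <= _).
  by apply: ler_sum_nat_widen => //; lia.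
have := hq K.+2; rewrite !(big_ltn (m := 1))//.
have : \sum_(2 <= i < K.+2) t p i <= \sum_(2 <= i < K.+2) t q i.
  by apply: ler_sum_nat => k /andP[k0 _]; apply/ltW/t_incr => //; [rewrite p0|lia].
lra.
Qed.

(** The root is the supremum s of the q <= 1/4 with partial sums at most 1. Continuity of finite
    sums puts s in this set; if the sums at s stayed below some d < 1, a slightly larger q would
    also belong to it. *)
Lemma series_root_unique_exists :
  exists! r, 0 < r < 1 /\ (\sum_(1 <= k <oo) (t r k)%:E = 1)%E.
Proof.
pose A := [set q | 0 < q <= 4^-1 /\ forall K, \sum_(1 <= k < K) t q k <= 1].
(* By [t_le] the terms are at most 8 / 9^k, whose sum over 1 <= k < K is 1 - 9^(-(K - 1)) for K >=
   1. *)
have A9 : A 9^-1.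
  have q9 : 0 < (9^-1 : R) <= 4^-1 by apply/andP; split; lra.
  split=> // K; apply: le_trans (_ : 1 - 9^-1 ^+ K.-1 <= _); last first.
    by rewrite gerBl exprn_ge0.
  case: K => [|K]; first by rewrite big_geq// expr0 subrr.
  elim: K => [|K IH]; first by rewrite big_geq// expr0 subrr.
  rewrite big_nat_recr//= exprS; have := t_le (k := K.+1) q9 isT.
  rewrite exprS; move: IH => /=; move: (9^-1 ^+ K) => x; lra.
have Aub : ubound A 4^-1 by move=> q [/andP[]].
have hA : has_sup A by split; [exists 9^-1|exists 4^-1].
pose s := sup A.
have s9 : 9^-1 <= s by apply: ub_le_sup => //; case: hA.
have s4 : s <= 4^-1 by apply: ge_sup => //; exists 9^-1.
have s01 : 0 < s < 1 by apply/andP; split; lra.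
have below q : 0 < q < s -> forall K, \sum_(1 <= k < K) t q k <= 1.
  move=> /andP[q0 qs] K.
  have [p [/andP[p0 p4] hp] qp] := sup_gt (ex_intro _ _ A9) qs.
  by apply: le_trans (hp K); apply: series_root_sum_le; [rewrite q0 ltW|lra].
have cS K : {for s, continuous (fun q => \sum_(1 <= k < K) t q k)}.
  by apply: continuous_sum => k k0; exact: t_cont.
have s1 K : \sum_(1 <= k < K) t s k <= 1.
  rewrite -subr_ge0; have /andP[s0 _] := s01.
  apply: (@ge_at_left_limit _ (fun q => 1 - \sum_(1 <= k < K) t q k) s 0) => //.
    by apply: cvgB; [exact: cvg_cst|exact: cS].
  by move=> q qs; rewrite subr_ge0 below.
have {}s4 : s < 4^-1.
  rewrite lt_neqAle s4 andbT; apply/eqP => sE; have := s1 3.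
  by rewrite sE big_nat_recr//= big_nat1 leNgt t_quarter.
have ss : (\sum_(1 <= k <oo) (t s k)%:E = 1)%E.
  apply/nneseries_eq1 => [k k0|]; first exact: t0.
  split=> // d hd; rewrite leNgt; apply/negP => d1.
  (* For q <= 1/4 the tail beyond [N] is at most 16 / 4^N, so half of the gap [1 - d] covers the
     tail and the other half the change of the head. *)
  have [N _ hN] : \forall n \near \oo, `|0 - geometric 16 4^-1 n| < (1 - d) / 2 :> R.
    have : geometric 16 (4^-1 : R) n @[n --> \oo] --> (0 : R).
      by apply: cvg_geometric; rewrite ger0_norm; lra.
    by move/cvgrPdist_lt; apply; lra.
  have {hN} := hN N (leqnn N); rewrite /= sub0r normrN ger0_norm; last first.
    by rewrite mulr_ge0// exprn_ge0.
  move=> hN.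
  have [q [sq q4 hq]] : exists q, [/\ s < q, q < 4^-1 &
      \sum_(1 <= k < N.+1) t q k <= d + (1 - d) / 2].
    apply: contrapT => nq.
    have : d + (1 - d) / 2 <= \sum_(1 <= k < N.+1) t s k.
      apply: (@ge_at_right_limit _ (fun q => \sum_(1 <= k < N.+1) t q k) s 4^-1) => //.
      move=> q /andP[sq q4]; rewrite leNgt; apply/negP => h; apply: nq.
      by exists q; split=> //; exact: ltW.
    have := hd N.+1; lra.
  have q0 : 0 < q by lra.
  suff : q <= s by lra.
  apply: ub_le_sup; first by case: hA.
  split; first by rewrite q0 ltW.
  move=> K; have tq k : (0 < k)%N -> 0 <= t q k by move=> k0; apply: t0 => //; lra.
  apply: le_trans (_ : \sum_(1 <= k < N.+1 + K) t q k <= _).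
    by apply: ler_sum_nat_widen => //; rewrite leq_addl.
  rewrite (big_cat_nat (n := N.+1))//=; last by rewrite leq_addr.
  suff : \sum_(N.+1 <= k < N.+1 + K) t q k <= 16 * 4^-1 ^+ N - 16 * 4^-1 ^+ (N + K).
    have : 0 <= 16 * 4^-1 ^+ (N + K) :> R by rewrite mulr_ge0// exprn_ge0.
    lra.
  elim: K => [|K IH]; first by rewrite addn0 big_geq// addn0 subrr.
  rewrite addnS big_nat_recr//=; last by rewrite leq_addr.
  have : t q (N.+1 + K) <= 8 * 4^-1 ^+ (N.+1 + K).
    apply: le_trans (t_le _ _) _ => //; first by rewrite q0 ltW.
    by rewrite ler_pM2l// lerXn2r ?nnegrE ?(ltW q0) ?(ltW q4)// invr_ge0.
  rewrite addnS addSn exprS.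
  have : 0 <= (4^-1 : R) ^+ (N + K) by rewrite exprn_ge0.
  move: IH; rewrite addSn; move: ((4^-1 : R) ^+ (N + K)) => x; lra.
exists s; split=> // p [/andP[p0 p1] hp].
have /andP[s0 s_1] := s01.
have [ps|ps|//] := ltgtP s p.
  by case: (series_root_inj s0 ps p1 ss hp).
by case: (series_root_inj p0 ps s_1 hp ss).
Qed.

End SeriesRoot.

(** * Faber polynomials on the focal segment and properties of the two term families *)

Section Final.
Variable R : realType.
Implicit Types (r q : R).

(** A point cos t of the segment is the image of w = r e^(it), where the Faber polynomial is a sum
    of two terms of modulus [r ^+ n.+1]. *)
Lemma normc_faber_segment r n (z : R[i]) : 0 < r -> focal_segment z ->
  normc (faber r n.+1).[z] <= 2 * r ^+ n.+1.
Proof.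
move=> r0 [x /=]; rewrite in_itv/= -ler_norml => x1 <-.
have rC : r%:C != 0 :> R[i] by rewrite (inj_eq (@complexI R)) gt_eqF.
pose u : R[i] := x +i* Num.sqrt (1 - x ^+ 2).
have u1 : normc u = 1.
  rewrite /= sqr_sqrtr; first by rewrite addrC subrK sqrtr1.
  by rewrite subr_ge0 -real_normK ?num_real// expr_le1.
have u0 := normc1_neq0 u1.
have -> : x%:C = joukowski r (r%:C * u).
  rewrite /joukowski (mulrC r%:C) mulfK// invfM mulrCA mulfV// mulr1.
  by rewrite -(conjc_unit u1) addcJ mulrA mulVf ?mul1r// pnatr_eq0.
rewrite faber_joukowski ?mulf_neq0//; apply: le_trans (le_normcD _ _) _.
rewrite normcM normcV !normcX !normcM u1 mulr1 !normc_real.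
rewrite !ger0_norm ?exprn_ge0 ?(ltW r0)//.
rewrite mulrDl mul1r lerD2l mul2n -addnn exprD mulfK// expf_neq0//.
by rewrite gt_eqF.
Qed.

Lemma sup_segment_faber r n : 0 < r ->
  0 <= sup_segment (faber r n.+1) <= 2 * r ^+ n.+1.
Proof.
move=> r0; have ub : ubound
    [set normc (faber r n.+1).[z] | z in @focal_segment R] (2 * r ^+ n.+1).
  by move=> _ [z /= zK <-]; exact: normc_faber_segment.
have s0 : @focal_segment R 0 by exists 0 => //=; rewrite in_itv/=; lra.
apply/andP; split; last by apply: ge_sup => //; exists (normc (faber r n.+1).[0]), 0.
apply: le_trans (normc_ge0 (faber r n.+1).[0]) _.
by apply: ub_le_sup; [exists (2 * r ^+ n.+1)|exists 0].
Qed.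

Lemma sup_segment1 : sup_segment (1 : {poly R[i]}) = 1.
Proof.
rewrite /sup_segment (_ : [set _ | _ in _] = [set 1]) ?sup1//.
apply/seteqP; split=> [_ [z _ <-]|_ ->]; first by rewrite hornerC normc1.
exists 0; last by rewrite hornerC normc1.
by exists 0 => //=; rewrite in_itv/=; lra.
Qed.

Lemma bohr_sum_lt1 r (a : nat -> R[i]) (d : R) : 0 < r -> d < 1 ->
  (forall K, normc (a 0%N) + \sum_(1 <= k < K) 2 * r ^+ k * normc (a k) <= d) ->
  (\sum_(0 <= n <oo) (normc (a n) * sup_segment (faber r n))%:E < 1)%E.
Proof.
move=> r0 d1 H; apply: (@le_lt_trans _ _ d%:E); last by rewrite lte_fin.
apply/nneseries_le.
  move=> [|k] _; first by rewrite /= sup_segment1 mulr1 normc_ge0.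
  by rewrite mulr_ge0 ?normc_ge0//; case/andP: (sup_segment_faber k r0).
move=> [|K].
  rewrite big_geq//; apply: le_trans (H 0%N); rewrite big_geq// addr0.
  exact: normc_ge0.
rewrite big_ltn//= sup_segment1 mulr1; apply: le_trans (H K.+1).
rewrite lerD2l; apply: ler_sum_nat => -[|k]// _.
rewrite mulrC ler_wpM2r ?normc_ge0//.
by case/andP: (sup_segment_faber k r0).
Qed.

Lemma bohr_term_incr p q k : 0 < p < q -> q < 1 -> (0 < k)%N ->
  even_bohr_term p k < even_bohr_term q k /\ bohr_term p k < bohr_term q k.
Proof.
move=> /andP[p0 pq] q1 k0; have q0 := lt_trans p0 pq.
rewrite /bohr_term /even_bohr_term !(mulnC 2) !exprM.
have : p ^+ k < q ^+ k by rewrite ltrXn2r ?nnegrE ?(ltW p0) ?(ltW q0) -?lt0n.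
have : 0 < p ^+ k by rewrite exprn_gt0.
have : q ^+ k < 1 by rewrite exprn_ilt1 ?(ltW q0) -?lt0n.
move: (p ^+ k) (q ^+ k) => x y y1 x0 xy.
have x2 : x ^+ 2 < y ^+ 2 by rewrite ltr_pXn2r ?nnegrE//; lra.
have y2 : y ^+ 2 < 1 by rewrite expr_lt1//; lra.
have x20 : 0 <= x ^+ 2 by exact: sqr_ge0.
have E : 4 * x / (1 + x ^+ 2) < 4 * y / (1 + y ^+ 2).
  rewrite ltr_pdivrMr ?ltr_pdivlMr//; [|lra..].
  rewrite mulrAC ltr_pdivlMr; last lra.
  (* The cross-multiplied difference is four times this product; for the odd terms the second factor
     becomes [1 + x * y]. *)
  have : 0 < (y - x) * (1 - x * y) by rewrite mulr_gt0//; nra.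
  lra.
split=> //; case: ifP => // _.
rewrite ltr_pdivrMr; last lra.
rewrite mulrAC ltr_pdivlMr; last lra.
have : 0 < (y - x) * (1 + x * y) by rewrite mulr_gt0//; nra.
lra.
Qed.

(** The lower bound serves the strictness argument, the upper bound the geometric tail estimate. *)
Lemma bohr_term_bounds q k : 0 < q <= 4^-1 -> (0 < k)%N ->
  2 * q ^+ k <= even_bohr_term q k <= bohr_term q k /\ bohr_term q k <= 8 * q ^+ k.
Proof.
move=> /andP[q0 q4] k0; rewrite /bohr_term /even_bohr_term !(mulnC 2) !exprM.
have : 0 < q ^+ k by rewrite exprn_gt0.
have : q ^+ k <= 4^-1.
  have q1 : q <= 1 by lra.
  case: k k0 => // k _; rewrite exprS; apply: le_trans q4.
  by rewrite ler_piMr ?exprn_ile1// ltW.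
move: (q ^+ k) => x x4 x0.
have x2 : x ^+ 2 <= 16^-1 by nra.
have x20 := sqr_ge0 x.
have A : 2 * x <= 4 * x / (1 + x ^+ 2) by rewrite ler_pdivlMr; nra.
have B : 4 * x / (1 + x ^+ 2) <= 4 * x / (1 - x ^+ 2).
  by rewrite ler_pM2l ?lef_pV2 ?posrE; lra.
have C : 4 * x / (1 - x ^+ 2) <= 8 * x by rewrite ler_pdivrMr; nra.
by rewrite A /=; case: ifP => _; rewrite ?B ?lexx; split=> //; apply: le_trans B C.
Qed.

Lemma bohr_eq0E r : 0 < r < 1 ->
  bohr_eq0 r <-> (\sum_(1 <= k <oo) (bohr_term r k)%:E = 1)%E.
Proof.
move=> /andP[r0 r1]; rewrite /bohr_eq0 eseries_mkcond.
rewrite [X in (_ + X)%E]eseries_mkcond -nneseriesD; last 2 first.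
- move=> k _ _; case: ifP => // _; rewrite lee_fin.
  by apply: even_bohr_term_ge0; exact: ltW.
- move=> k k0 _; case: ifP => // ok; rewrite lee_fin.
  have := @bohr_term_ge0 R r k; rewrite /bohr_term ok; apply.
  by rewrite ltW.
rewrite (eq_eseriesr (g := fun k => (bohr_term r k)%:E))// => k _.
by rewrite /bohr_term; case: (odd k); rewrite /= ?adde0 ?add0e.
Qed.

(** First [q] tends to [r] with [C] fixed, then [C] tends to 1. *)
Lemma le_right_limit_sum (t : R -> nat -> R) r (al P : R) K :
  0 < r < 4^-1 -> (forall k, (0 < k)%N -> {for r, continuous (t ^~ k)}) ->
  (forall q C, r < q < 4^-1 -> 1 < C -> P <= (C - al) * \sum_(1 <= k < K) t q k) ->
  P <= (1 - al) * \sum_(1 <= k < K) t r k.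
Proof.
move=> /andP[r0 r4] ct H.
have cS := @continuous_sum R t K r ct.
have {}H C : 1 < C -> P <= (C - al) * \sum_(1 <= k < K) t r k.
  move=> C1.
  apply: (@ge_at_right_limit _
    (fun q => (C - al) * \sum_(1 <= k < K) t q k) r 4^-1) => //.
    by apply: cvgM; [exact: cvg_cst|exact: cS].
  by move=> q rq; exact: H.
apply: (@ge_at_right_limit _ (fun C => (C - al) * \sum_(1 <= k < K) t r k) 1 2); first lra.
  apply: cvgM; last exact: cvg_cst.
  by apply: cvgB; [exact: cvg_id|exact: cvg_cst].
by move=> C /andP[C1 _]; exact: H.
Qed.

End Final.

Theorem proposition4p5 (R : realType) :
  ((exists! R0 : R, 0 < R0 < 1 /\ bohr_eq0 R0) /\
   forall R0 : R, 0 < R0 < 1 -> bohr_eq0 R0 ->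
   forall r : R, 0 < r <= R0 ->
     bohr_phenomenon r [set f | holomorphic_on (ellipse r) f]) /\
  ((exists! R1 : R, 0 < R1 < 1 /\ bohr_eq1 R1) /\
   forall R1 : R, 0 < R1 < 1 -> bohr_eq1 R1 ->
   forall r : R, 0 < r <= R1 ->
     bohr_phenomenon r
       [set f | holomorphic_on (ellipse r) f /\ real_faber_coefs r f]).
Proof.
have t0 (q : R) k : 0 < q < 1 -> (0 < k)%N -> 0 <= bohr_term q k.
  by move=> /andP[q0 q1] _; rewrite bohr_term_ge0// ltW.
have s0 (q : R) k : 0 < q < 1 -> (0 < k)%N -> 0 <= even_bohr_term q k.
  by move=> /andP[q0 q1] _; rewrite even_bohr_term_ge0// ltW.
have ti (p q : R) k pq q1 k0 := (@bohr_term_incr R p q k pq q1 k0).2.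
have si (p q : R) k pq q1 k0 := (@bohr_term_incr R p q k pq q1 k0).1.
have tc (q : R) k : 0 < q < 1 -> (0 < k)%N ->
  {for q, continuous (fun q => bohr_term q k)} by exact: continuous_bohr_term.
have sc (q : R) k : 0 < q < 1 -> (0 < k)%N ->
  {for q, continuous (fun q => even_bohr_term q k)}.
  by move=> _ _; exact: continuous_even_bohr_term.
have tl (q : R) k q4 k0 := (@bohr_term_bounds R q k q4 k0).2.
have sl (q : R) k : 0 < q <= 4^-1 -> (0 < k)%N -> even_bohr_term q k <= 8 * q ^+ k.
  by move=> q4 k0; apply: le_trans (tl q k q4 k0);
    case: (bohr_term_bounds q4 k0) => /andP[].
have s4 : 1 < even_bohr_term 4^-1 1 + even_bohr_term (4^-1 : R) 2.
  have -> : even_bohr_term 4^-1 1 + even_bohr_term 4^-1 2 = 16 / 17 + 64 / 257 :> R.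
    by rewrite /even_bohr_term /=; field.
  lra.
have t4 : 1 < bohr_term 4^-1 1 + bohr_term (4^-1 : R) 2.
  apply: lt_le_trans s4 _; have q4 : 0 < (4^-1 : R) <= 4^-1.
    by rewrite lexx invr_gt0 ltr0n.
  have le k : (0 < k)%N -> even_bohr_term 4^-1 k <= bohr_term (4^-1 : R) k.
    by move=> k0; case: (bohr_term_bounds q4 k0) => /andP[].
  by rewrite lerD ?le.
split; split.
- have [r0 [[r01 h] u]] := series_root_unique_exists t0 ti tc tl t4.
  exists r0; split; first by split=> //; exact/bohr_eq0E.
  by move=> p [p01 /(bohr_eq0E p01) hp]; exact: u.
- move=> R0 R01 /(bohr_eq0E R01) hR0 r /andP[r0 rR] f a _ fa f1.
  (* This leaves room for q between r and 1/4, where the kernel inequality holds. *)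
  have R4 := series_root_lt t0 ti t4 R01 hR0.
  have r4 : 0 < r < 4^-1 by rewrite r0 (le_lt_trans rR).
  have r1 : r < 1 by case/andP: R01 => _; exact: le_lt_trans.
  have [d d1 H] : exists2 d, d < 1 & forall K,
      normc (a 0%N) + \sum_(1 <= k < K) 2 * r ^+ k * normc (a k) <= d.
    apply: (bohr_partial_sum_lt1 r0 fa f1 (t := bohr_term r)) => //.
    + move=> k k0; have r4' : 0 < r <= 4^-1 by case/andP: r4 => -> /ltW.
      by case: (bohr_term_bounds r4' k0) => /andP[h1 h2] _; apply: le_trans h2.
    + move=> K; have [h _] := (nneseries_eq1 (fun k => t0 R0 k R01)).1 hR0.
      apply: le_trans (h K); apply: (series_root_sum_le ti); first by rewrite r0.
      by case/andP: R01.
    + move=> K; apply: (le_right_limit_sum (t := @bohr_term R) r4).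
        by move=> k k0; apply: tc => //; rewrite r0.
      move=> q C /andP[rq q4] C1; apply: (sum_coef_le r0 fa f1) => //; exact: ltW.
  exact: bohr_sum_lt1 r0 d1 H.
- exact: series_root_unique_exists s0 si sc sl s4.
- move=> R1 R11 hR1 r /andP[r0 rR] f a [_ ar] fa f1.
  have R4 := series_root_lt s0 si s4 R11 hR1.
  have r4 : 0 < r < 4^-1 by rewrite r0 (le_lt_trans rR).
  have r1 : r < 1 by case/andP: R11 => _; exact: le_lt_trans.
  have [d d1 H] : exists2 d, d < 1 & forall K,
      normc (a 0%N) + \sum_(1 <= k < K) 2 * r ^+ k * normc (a k) <= d.
    apply: (bohr_partial_sum_lt1 r0 fa f1 (t := even_bohr_term r)) => //.
    + move=> k k0; have r4' : 0 < r <= 4^-1 by case/andP: r4 => -> /ltW.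
      by case: (bohr_term_bounds r4' k0) => /andP[].
    + move=> K; have [h _] := (nneseries_eq1 (fun k => s0 R1 k R11)).1 hR1.
      apply: le_trans (h K); apply: (series_root_sum_le si); first by rewrite r0.
      by case/andP: R11.
    + move=> K; apply: (le_right_limit_sum (t := @even_bohr_term R) r4).
        by move=> k k0; apply: sc => //; rewrite r0.
      move=> q C /andP[rq q4] C1; apply: (sum_real_coef_le r0 fa f1) => //.
        exact: ar.
      by apply: lt_trans q4 _; lra.
  exact: bohr_sum_lt1 r0 d1 H.
Qed.
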